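(* Let $k$ be a positive integer and let $N>2k$ be an integer. If $k=2m$ for some positive integer $m$, then for all $u\in C_0^\infty(\mathbb{H}^N)$ $$\int_{\mathbb{H}^{N}} (\Delta_{\mathbb{H}^{N}}^{m} u)^2 \, dv_{\mathbb{H}^{N}} - \left( \frac{N-1}{2} \right)^{2} \int_{\mathbb{H}^{N}} |\nabla_{\mathbb{H}^{N}} (\Delta_{\mathbb{H}^{N}}^{m-1} u)|^{2} \, dv_{\mathbb{H}^{N}} \geq \frac{(N-1)^{2m}}{2^{4m}} \int_{\mathbb{H}^{N}} \frac{u^2}{r^{2}} \, dv_{\mathbb{H}^{N}} + \frac{9}{2^{4m}} \prod_{j = 1}^{ m-1} \big((N+ 4j )(N- 4j -4)\big)^2 \int_{\mathbb{H}^{N}} \frac{u^2}{r^{4m}} \, dv_{\mathbb{H}^{N}},$$ with the convention $\prod_{j=1}^{0}=1$. If $k=2m+1$ for some positive integer $m$, then for all $u\in C_0^\infty(\mathbb{H}^N)$ $$\int_{\mathbb{H}^{N}} |\nabla_{\mathbb{H}^{N}} (\Delta_{\mathbb{H}^{N}}^{m} u)|^{2} \, dv_{\mathbb{H}^{N}} - \left( \frac{N-1}{2} \right)^{2} \int_{\mathbb{H}^{N}} (\Delta_{\mathbb{H}^{N}}^{m} u)^{2} \, dv_{\mathbb{H}^{N}} \geq \frac{(N-1)^{2m}}{2^{4m+2}} \int_{\mathbb{H}^{N}} \frac{u^2}{r^{2}} \, dv_{\mathbb{H}^{N}} + \frac{1}{2^{4m+2}} \prod_{j = 1}^{m}(N+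 4j-2)^2(N - 4j- 2)^2 \int_{\mathbb{H}^{N}} \frac{u^2}{r^{4m+2}} \, dv_{\mathbb{H}^{N}}.$$
   Context: $\mathbb{H}^N$ is the $N$-dimensional hyperbolic space (constant sectional curvature $-1$), $dv_{\mathbb{H}^N}$ its volume measure, $\nabla_{\mathbb{H}^N}$ the Riemannian gradient, $\Delta_{\mathbb{H}^N}$ the Laplace-Beltrami operator and $\Delta_{\mathbb{H}^N}^m$ its $m$-th iterate ($\Delta^0_{\mathbb{H}^N}$ is the identity). A pole $x_0\in\mathbb{H}^N$ is fixed and $r:=\varrho(x,x_0)$ is the geodesic distance from $x$ to $x_0$. $C_0^\infty(\mathbb{H}^N)$ denotes smooth compactly supported functions. *)

(* Defs.v *)
From HB Require Import structures.
From mathcomp Require Import all_boot all_order all_algebra.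
From mathcomp Require Import all_classical all_reals all_analysis.

Set Implicit Arguments.
Unset Strict Implicit.
Unset Printing Implicit Defensive.

Import Order.TTheory GRing.Theory Num.Theory.
Import numFieldNormedType.Exports.

Local Open Scope classical_set_scope.
Local Open Scope ring_scope.

(* Lebesgue measure on R^n, carried by the library's measurable type of
   n-tuples: the n-fold product of the one-dimensional Lebesgue measure,
   transported along R * R^n -> R^(n+1). *)

Definition tuple_cons (R : realType) (n : nat)
    (p : (measurableTypeR R * n.-tuple (measurableTypeR R))%type) :
    n.+1.-tuple (measurableTypeR R) :=
  [tuple of p.1 :: p.2].

Lemma measurable_tuple_cons (R : realType) (n : nat) :
  measurable_fun setT (@tuple_cons R n).
Proof. exact: measurable_cons. Qed.

Section push_cons.
Context (R : realType) (n : nat).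
Context (mu : {sigma_finite_measure set (n.-tuple (measurableTypeR R)) -> \bar R}).

Definition push_cons : set (n.+1.-tuple (measurableTypeR R)) -> \bar R :=
  pushforward (@lebesgue_measure R \x mu)%E (@tuple_cons R n).

Let push_cons0 : push_cons set0 = 0%E.
Proof. by rewrite /push_cons /pushforward preimage_set0 measure0. Qed.

Let push_cons_ge0 A : (0 <= push_cons A)%E.
Proof. by rewrite /push_cons /pushforward measure_ge0. Qed.

Let push_cons_sigma_additive : semi_sigma_additive push_cons.
Proof.
have := @measure_semi_sigma_additive _ _ _
  (measure_function_pushforward__canonical__measure_function_Measure
     (@lebesgue_measure R \x mu)%E (@measurable_tuple_cons R n)).
exact.
Qed.

HB.instance Definition _ := isMeasure.Build _ _ _ push_cons
  push_cons0 push_cons_ge0 push_cons_sigma_additive.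

Let push_cons_sigma_finite : sigma_finite setT push_cons.
Proof.
have /sigma_finiteP[F [TF ndF Foo]] := sigma_finiteT (@lebesgue_measure R).
have /sigma_finiteP[G [TG ndG Goo]] := sigma_finiteT mu.
pose h (t : n.+1.-tuple (measurableTypeR R)) :
    (measurableTypeR R * n.-tuple (measurableTypeR R))%type :=
  (thead t, [tuple of behead t]).
have mh : measurable_fun setT h.
  apply/measurable_fun_pair; first exact: measurable_tnth.
  exact: measurable_behead.
have hK : cancel (@tuple_cons R n) h.
  by move=> [x t]; congr pair; apply/val_inj.
exists (fun k => h @^-1` (F k `*` G k)).
  apply/seteqP; split=> // t _.
  have [i _ Fi] : (\bigcup_i F i) (h t).1 by rewrite -TF.
  have [j _ Gj] : (\bigcup_i G i) (h t).2 by rewrite -TG.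
  exists (maxn i j) => //; split.
    by move: Fi; exact/subsetPset/ndF/leq_maxl.
  by move: Gj; exact/subsetPset/ndG/leq_maxr.
move=> k; have [mF Fk] := Foo k; have [mG Gk] := Goo k; split.
  by rewrite -[X in measurable X]setTI; apply: mh => //; exact: measurableX.
rewrite /push_cons /pushforward -comp_preimage.
rewrite (_ : h \o _ = id); last exact/funext.
by rewrite preimage_id product_measure1E// lte_mul_pinfty// ge0_fin_numE.
Qed.

HB.instance Definition _ := Measure_isSigmaFinite.Build _ _ _
  push_cons push_cons_sigma_finite.

End push_cons.

Fixpoint lebesgue_tuple (R : realType) (n : nat) :
    {sigma_finite_measure set (n.-tuple (measurableTypeR R)) -> \bar R} :=
  match n with
  | 0 => dirac [tuple]
  | n'.+1 => push_cons (lebesgue_tuple R n')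
  end.

Definition partial (R : realType) (n : nat) (i : 'I_n) (f : 'rV[R]_n -> R) :
    'rV[R]_n -> R :=
  fun x => 'D_(delta_mx 0 i) f x.

(* C^oo: partial derivatives of every order exist and are continuous. *)
Definition smooth (R : realType) (n : nat) (f : 'rV[R]_n -> R) : Prop :=
  forall s : seq 'I_n,
    let g := foldr (@partial R n) f s in
    continuous g /\ forall x i, derivable g x (delta_mx 0 i).

(* C_0^oo(D), for D open in R^n; a function on D with compact support is
   identified with its extension by zero to R^n. *)
Definition test_function (R : realType) (n : nat) (D : set 'rV[R]_n)
    (u : 'rV[R]_n -> R) : Prop :=
  [/\ smooth u,
      compact (closure [set x | u x != 0]) &
      closure [set x | u x != 0] `<=` D].

(* Riemannian geometry of an open set D of R^n in its global coordinates;
   g x is the Gram matrix (g_ij) of the metric at x. *)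

Definition metric_sqnorm (R : realType) (n : nat) (g : 'rV[R]_n -> 'M[R]_n)
    (x v : 'rV[R]_n) : R :=
  (v *m g x *m v^T) 0 0.

Definition vol_density (R : realType) (n : nat) (g : 'rV[R]_n -> 'M[R]_n)
    (x : 'rV[R]_n) : R :=
  Num.sqrt (\det (g x)).

(* (grad u)^j = sum_i g^ij d_i u *)
Definition grad (R : realType) (n : nat) (g : 'rV[R]_n -> 'M[R]_n)
    (u : 'rV[R]_n -> R) (x : 'rV[R]_n) : 'rV[R]_n :=
  (\row_i partial i u x) *m invmx (g x).

(* Delta u = |g|^(-1/2) sum_j d_j (|g|^(1/2) (grad u)^j) *)
Definition laplace_beltrami (R : realType) (n : nat)
    (g : 'rV[R]_n -> 'M[R]_n) (u : 'rV[R]_n -> R) (x : 'rV[R]_n) : R :=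
  (vol_density g x)^-1 *
  \sum_(j < n) partial j (fun y => vol_density g y * grad g u y 0 j) x.

Definition curve_length (R : realType) (n : nat) (g : 'rV[R]_n -> 'M[R]_n)
    (c : R -> 'rV[R]_n) : R :=
  \int[lebesgue_measure]_(s in `[0, 1])
    Num.sqrt (metric_sqnorm g (c s) (derive1 c s)).

(* The C^1 curves are parametrized by [0, 1]; asking c to be C^1 on all of R is
   no restriction, since a C^1 curve on [0, 1] extends affinely. *)
Definition geodesic_dist (R : realType) (n : nat) (D : set 'rV[R]_n)
    (g : 'rV[R]_n -> 'M[R]_n) (x y : 'rV[R]_n) : R :=
  inf [set L | exists c : R -> 'rV[R]_n,
    [/\ forall s, derivable c s 1,
        continuous (derive1 c),
        forall s, 0 <= s <= 1 -> D (c s),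
        c 0 = x /\ c 1 = y &
        L = curve_length g c]].

Definition riemannian_integral (R : realType) (n : nat) (D : set 'rV[R]_n)
    (g : 'rV[R]_n -> 'M[R]_n) (f : 'rV[R]_n -> R) : \bar R :=
  let row (t : n.-tuple (measurableTypeR R)) : 'rV[R]_n := \row_i tnth t i in
  (\int[lebesgue_tuple R n]_(t in row @^-1` D)
     (f (row t) * vol_density g (row t))%:E)%E.

(* Hyperbolic space in the Poincare ball model: the unit ball of R^n with the
   metric 4 |dx|^2 / (1 - |x|^2)^2, of constant sectional curvature -1.  The
   library norm on 'rV[R]_n is the sup norm, hence the explicit Euclidean one. *)

Definition euclid_sqnorm (R : realType) (n : nat) (x : 'rV[R]_n) : R :=
  \sum_(i < n) x 0 i ^+ 2.

Definition hyp_space (R : realType) (n : nat) : set 'rV[R]_n :=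
  [set x | euclid_sqnorm x < 1].

Definition hyp_metric (R : realType) (n : nat) (x : 'rV[R]_n) : 'M[R]_n :=
  ((2 / (1 - euclid_sqnorm x)) ^+ 2)%:M.

Definition hyp_integral (R : realType) (n : nat) (f : 'rV[R]_n -> R) : \bar R :=
  riemannian_integral (@hyp_space R n) (@hyp_metric R n) f.

Definition hyp_laplacian (R : realType) (n : nat) :
    ('rV[R]_n -> R) -> 'rV[R]_n -> R :=
  laplace_beltrami (@hyp_metric R n).

Definition hyp_grad_sqnorm (R : realType) (n : nat) (u : 'rV[R]_n -> R)
    (x : 'rV[R]_n) : R :=
  metric_sqnorm (@hyp_metric R n) x (grad (@hyp_metric R n) u x).

Definition hyp_dist (R : realType) (n : nat) (x y : 'rV[R]_n) : R :=
  geodesic_dist (@hyp_space R n) (@hyp_metric R n) x y.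

(* Main.v *)
(* In the Poincare ball let p(x) = cosh d(x, x0), q = kap p with kap > 1, and
   r = arccosh q.  Since Hess p = p g, also Hess q = q g, while
   |grad q|^2 = q^2 - kap^2; hence r is a smooth function which decreases to the
   distance to the pole as kap -> 1, tau := |grad r|^2 lies in [0, 1], and
   Delta r = (N - tau) coth r.  For radial weights w(r) the divergence theorem
   and the completion of a square give lower bounds of the integral of
   - w(r) u Delta u by radial potentials (radial_ineq).  These potentials are
   affine in tau, so that the bounds need to be checked at tau = 0 and tau = 1
   only.  The powers w = r^-k yield the weighted Rellich inequalities.  For the
   Poincare-Rellich inequality, with lam = (N-1)^2/4, one expands
   (Delta u + (lam + csch^2 r) u)^2 >= 0, which leaves the weights 1 and csch^2 r.
   Monotone convergence removes kap; only the lower bound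
   d(x, x0) >= r(x) - r(x0) of the geodesic distance is needed, and it follows
   from |grad r| <= 1. *)
Require Import Defs.
From HB Require Import structures.
From mathcomp Require Import all_boot all_order all_algebra.
From mathcomp Require Import all_classical all_reals all_analysis.
From mathcomp Require Import measurable_realfun ring lra.

Set Implicit Arguments.
Unset Strict Implicit.
Unset Printing Implicit Defensive.

Import Order.TTheory GRing.Theory Num.Theory.
Import numFieldNormedType.Exports.

Local Open Scope classical_set_scope.
Local Open Scope ring_scope.

(** * Integration of continuous compactly supported functions *)

Section tuple_integral.
Context {R : realType}.

(** The pole forces the regularisation: the negative powers of the true distance are singular there,
    so the divergence theorem would need an excision. With [kap > 1] one has q >= kap > 1 on the
    whole ball and every weight is differentiable there. The price is that |grad r| is below 1,
    which is why each bound has a companion at tau = 0. The constants arise as follows, with n = N -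
    1. For k = 2m, Poincare-Rellich for v = Delta^(m-1) u leaves n^2/16 v^2/r^2 and 9/16 v^2/r^4,
    which descend to u along two separate chains. In one, the weight r^-2 reproduces itself with a
    factor n^2/16 per Laplacian; in the other, r^-k becomes r^-(k+4) with the factor
    ((N-k-4)(N+k)/4)^2. For k = 2m+1, Poincare-Hardy for Delta^m u leaves only 1/(4 r^2), and one
    Rellich inequality that keeps both r^-2 and r^-6 starts the two chains. The assumption N > 2k
    keeps all these Rellich constants nonnegative. The geodesic distance is an infimum over curves
    and is never shown to be measurable or to equal arccosh p; since its integrals stand on the
    smaller side, a one-sided comparison suffices. *)

Definition row_of n (t : n.-tuple (measurableTypeR R)) : 'rV[R]_n :=
  \row_i tnth t i.

Definition grid n (k : nat) (z : 'I_n -> int) : 'rV[R]_n :=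
  \row_i ((z i)%:~R / k.+1%:R).

Lemma grid_dist n (x : 'rV[R]_n) k :
  `|x - grid k (fun i => Num.floor (x 0 i * k.+1%:R))| <= k.+1%:R^-1.
Proof.
rewrite [leLHS]/Num.Def.normr/= mx_normrE bigmax_le ?invr_ge0 ?ler0n// => -[i j] _.
rewrite !mxE /= (ord1 i) ler_norml.
have k0 : 0 < k.+1%:R :> R by rewrite ltr0n.
have /andP[h1 h2] := floor_itv (x 0 j * k.+1%:R).
set z := Num.floor _ in h1 h2 *.
rewrite -[x 0 j](@mulfK _ k.+1%:R) ?gt_eqF// -mulrBl; apply/andP; split.
  rewrite -[leLHS]mul1r mulrN -mulNr ler_pM2r ?invr_gt0//.
  by rewrite (le_trans (lerN10 R))// subr_ge0.
by rewrite -[leRHS]mul1r ler_pM2r ?invr_gt0// lerBlDl ltW// -intrD1.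
Qed.

Lemma grid_cvg n (x : 'rV[R]_n) :
  grid k (fun i => Num.floor (x 0 i * k.+1%:R)) @[k --> \oo] --> x.
Proof.
apply/cvgrPdist_le => e e0; near=> k.
apply: le_trans (grid_dist _ _) _.
rewrite -(invrK e) lef_pV2 ?posrE ?ltr0n ?invr_gt0//.
near: k; exists (Num.truncn e^-1) => // k /= ek.
rewrite ltW// (lt_le_trans (truncnS_gt _))// ler_nat ltnS//.
Unshelve. all: by end_near. Qed.

Lemma measurable_floor_eq (a : R) (z : int) :
  measurable [set x : measurableTypeR R | Num.floor (x * a) = z].
Proof.
have -> : [set x : measurableTypeR R | Num.floor (x * a) = z] =
   (fun x : R => x * a) @^-1` `[z%:~R, (z + 1)%:~R[%classic.
  apply/seteqP; split => x /=; rewrite in_itv/=.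
    by move=> <-; exact: floor_itv.
  by move/floor_def.
rewrite -[X in measurable X]setTI.
apply: continuous_measurable_fun => //.
by move=> x; apply: cvgM; [exact: cvg_id|exact: cvg_cst].
Qed.

(* The Borel structure of tuples is generated by the coordinates, so continuity
   only yields measurability through the (countable) grids of mesh 1/(k+1). *)
Lemma measurable_continuous_row n (f : 'rV[R]_n -> R) : continuous f ->
  measurable_fun [set: n.-tuple (measurableTypeR R)] (f \o @row_of n).
Proof.
move=> cf.
pose h k (t : n.-tuple (measurableTypeR R)) :=
  f (grid k (fun i => Num.floor (row_of t 0 i * k.+1%:R))).
apply: (@measurable_fun_cvg _ _ _ _ h); last first.
  by move=> t _; apply: (@cvg_comp _ _ _ _ f _ _ _ (@grid_cvg n (row_of t))); exact: cf.
move=> k _ Y mY; rewrite setTI.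
(* On a cell where all the floors are prescribed [h k] is constant, and there are only countably
   many cells. *)
pose B (z : n.-tuple int) := if asbool (Y (f (grid k (tnth z)))) then
  \bigcap_(i in [set: 'I_n]) [set t : n.-tuple (measurableTypeR R) |
     Num.floor (tnth t i * k.+1%:R) = tnth z i] else set0.
have -> : h k @^-1` Y = \bigcup_z B z.
  apply/seteqP; split => [t /= Yt|t [z _]].
    exists [tuple Num.floor (tnth t i * k.+1%:R) | i < n] => //.
    rewrite /B; case: asboolP => [_ i _ /=|]; first by rewrite tnth_mktuple.
    case; move: Yt; rewrite /h; congr (Y (f (grid _ _))).
    by apply/funext => i; rewrite tnth_mktuple mxE.
  rewrite /B; case: asboolP => // Yz zt.
  rewrite /h /= (_ : (fun i => _) = tnth z)//.
  by apply/funext => i; rewrite mxE; apply: zt.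
apply: countable_bigcupT_measurable => [|z]; first exact: countableP.
rewrite /B; case: ifP => // _; apply: fin_bigcap_measurable => // i _.
have := @measurable_tnth _ (measurableTypeR R) n i measurableT _
  (@measurable_floor_eq k.+1%:R (tnth z i)).
by rewrite setTI.
Qed.

Definition box n (M : R) : set (n.-tuple (measurableTypeR R)) :=
  [set t | forall i, `|tnth t i| <= M].
Arguments box : clear implicits.

Lemma measurable_box n M : measurable (box n M).
Proof.
have -> : box n M = \bigcap_(i in [set: 'I_n])
   ((fun t : n.-tuple (measurableTypeR R) => tnth t i) @^-1` `[- M, M]%classic).
  by apply/seteqP; split => t /= h i; [move=> _|move: (h i Logic.I)];
    rewrite /= in_itv/= -ler_norml.
apply: fin_bigcap_measurable => // i _.
by rewrite -[X in measurable X]setTI; apply: measurable_tnth.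
Qed.

Lemma lebesgue_box_lty n M : (lebesgue_tuple R n (box n M) < +oo)%E.
Proof.
elim: n => [|n IH] /=.
  by rewrite diracE; case: (_ \in _); rewrite ltry.
rewrite /push_cons /pushforward.
have -> : @tuple_cons R n @^-1` box n.+1 M = `[- M, M]%classic `*` box n M.
  apply/seteqP; split => [[x t] /= h|[x t] /= [h1 h2] i].
    split; first by have := h ord0; rewrite in_itv/= -ler_norml (tnth_nth 0).
    by move=> i; have := h (lift ord0 i); rewrite tnthS.
  move: h1; rewrite in_itv/= -ler_norml => h1.
  by have [j ->|->] := unliftP ord0 i; [rewrite tnthS|rewrite (tnth_nth 0)].
rewrite product_measure1E//; last exact: measurable_box.
rewrite lte_mul_pinfty ?measure_ge0//.
have := lebesgue_measure_itv `[- M, M]%R; rewrite /= => ->.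
by case: ifP => // _; rewrite -EFinB.
Qed.

Definition bounded_support n (f : 'rV[R]_n -> R) :=
  exists M, forall x, f x != 0 -> forall i, `|x 0 i| <= M.

Definition Cc n (f : 'rV[R]_n -> R) := continuous f /\ bounded_support f.

Lemma Cc_bounded n (f : 'rV[R]_n -> R) : Cc f ->
  exists C, forall x, `|f x| <= C.
Proof.
move=> [cf [M hM]].
have : compact (f @` [set v : 'rV[R]_n | forall i, `[- M, M]%classic (v ord0 i)]).
  apply: continuous_compact; first exact: continuous_subspaceT.
  apply: (@rV_compact _ n (fun=> `[- M, M]%classic)) => _.
  exact: segment_compact.
move=> /compact_bounded[C [_ /(_ (`|C| + 1))]].
have -> : (C < `|C| + 1) by rewrite (le_lt_trans (ler_norm _))// ltrDl.
move=> /(_ isT) h; exists (`|C| + 1) => x.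
have [->|fx] := eqVneq (f x) 0; first by rewrite normr0 addr_ge0.
apply: h; exists x => //= i.
by rewrite in_itv/= -ler_norml hM.
Qed.

(** The function is bounded and vanishes off a box of finite measure. *)
Lemma Cc_integrable n (f : 'rV[R]_n -> R) : Cc f ->
  (lebesgue_tuple R n).-integrable setT (EFin \o (f \o @row_of n)).
Proof.
move=> ccf; have [C hC] := Cc_bounded ccf.
have [cf [M hM]] := ccf.
have -> : EFin \o (f \o @row_of n) = (EFin \o (f \o @row_of n)) \_ (box n M).
  apply/funext => t; rewrite patchE; case: ifPn => // tM /=.
  congr EFin; apply: contrapT => /eqP/hM h; move/negP: tM; apply.
  by rewrite inE => i; have := h i; rewrite mxE.
apply/integrable_restrict => //; rewrite ?setTI; first exact: measurable_box.
apply: measurable_bounded_integrable.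
- exact: measurable_box.
- exact: lebesgue_box_lty.
- by apply: measurable_funTS; exact: measurable_continuous_row.
- by exists C; split; [exact: num_real|move=> y /ltW Cy t _; exact: le_trans (hC _) Cy].
Qed.

Definition Int n (f : 'rV[R]_n -> R) : R :=
  (\int[lebesgue_tuple R n]_t f (row_of t)).

Lemma IntE n (f : 'rV[R]_n -> R) : Cc f ->
  (\int[lebesgue_tuple R n]_t (f (row_of t))%:E)%E = (Int f)%:E.
Proof.
move=> ccf; rewrite /Int /Rintegral fineK//.
exact: (integrable_fin_num _ (Cc_integrable ccf)).
Qed.

Lemma CcD n (f g : 'rV[R]_n -> R) : Cc f -> Cc g -> Cc (fun x => f x + g x).
Proof.
move=> [cf [M hM]] [cg [M' hM']]; split; first by move=> x; exact: (cvgD (cf x) (cg x)).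
exists (Num.max M M') => x fg i; rewrite le_max.
have [f0|/hM/(_ i) ->//] := eqVneq (f x) 0.
by move: fg; rewrite f0 add0r => /hM' ->; rewrite orbT.
Qed.

Lemma Cc0 n : Cc (fun _ : 'rV[R]_n => 0).
Proof.
by split; [exact: cst_continuous|exists 0 => x; rewrite eqxx].
Qed.

Lemma Cc_sum n (I : Type) (s : seq I) (f : I -> 'rV[R]_n -> R) :
  (forall i, Cc (f i)) -> Cc (fun x => \sum_(i <- s) f i x).
Proof.
move=> cf; elim: s => [|i s IH].
  have -> : (fun x => \sum_(i <- [::]) f i x) = fun=> 0.
    by apply/funext => x; rewrite big_nil.
  exact: Cc0.
have -> : (fun x => \sum_(j <- i :: s) f j x) =
    fun x => f i x + \sum_(j <- s) f j x.
  by apply/funext => x; rewrite big_cons.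
exact: CcD.
Qed.

Lemma IntD n (f g : 'rV[R]_n -> R) : Cc f -> Cc g ->
  Int (fun x => f x + g x) = Int f + Int g.
Proof. by move=> cf cg; apply: RintegralD => //; exact: Cc_integrable. Qed.

Lemma IntZ n a (f : 'rV[R]_n -> R) : Cc f -> Int (fun x => a * f x) = a * Int f.
Proof.
by move=> cf; rewrite /Int -RintegralZl//; exact: (Cc_integrable cf).
Qed.

Lemma Int_sum n (I : Type) (s : seq I) (f : I -> 'rV[R]_n -> R) :
  (forall i, Cc (f i)) ->
  Int (fun x => \sum_(i <- s) f i x) = \sum_(i <- s) Int (f i).
Proof.
move=> cf; elim: s => [|i s IH].
  have -> : (fun x => \sum_(i <- [::]) f i x) = fun=> 0.
    by apply/funext => x; rewrite big_nil.
  by rewrite big_nil /Int /Rintegral integral0.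
rewrite big_cons -IH -IntD//; last exact: Cc_sum.
by congr Int; apply/funext => x; rewrite big_cons.
Qed.

Lemma le_Int n (f g : 'rV[R]_n -> R) : Cc f -> Cc g ->
  (forall x, f x <= g x) -> Int f <= Int g.
Proof.
by move=> cf cg fg; apply: le_Rintegral => //; exact: Cc_integrable.
Qed.

Lemma Int_ge0 n (f : 'rV[R]_n -> R) : (forall x, 0 <= f x) -> 0 <= Int f.
Proof. by move=> f0; apply: Rintegral_ge0. Qed.

End tuple_integral.

(** * Integrals of partial derivatives *)

Section divergence.
Context {R : realType}.

Definition consr n (a : R) (y : 'rV[R]_n) : 'rV[R]_n.+1 :=
  \row_k oapp (y 0) a (unlift ord0 k).

Lemma row_of_cons n p : row_of (@tuple_cons R n p) = consr p.1 (row_of p.2).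
Proof.
apply/rowP => k; rewrite !mxE; case: (unliftP ord0 k) => [j ->|->] /=.
  by rewrite tnthS mxE /=; congr tnth; apply/val_inj.
by rewrite (tnth_nth 0).
Qed.

Lemma consr0 n a (y : 'rV[R]_n) : consr a y 0 ord0 = a.
Proof. by rewrite mxE unlift_none. Qed.

Lemma consrS n a (y : 'rV[R]_n) i : consr a y 0 (lift ord0 i) = y 0 i.
Proof. by rewrite mxE liftK. Qed.

Lemma consrDl n (h a : R) (y : 'rV[R]_n) :
  consr (h + a) y = h *: delta_mx 0 ord0 + consr a y.
Proof.
apply/rowP => k; have [j ->|->] := unliftP ord0 k.
  by rewrite consrS !mxE liftK /= mulr0 add0r.
by rewrite consr0 !mxE unlift_none /= mulr1.
Qed.

Lemma consrDr n (h a : R) (y : 'rV[R]_n) i :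
  consr a (h *: delta_mx 0 i + y) = h *: delta_mx 0 (lift ord0 i) + consr a y.
Proof.
apply/rowP => k; have [j ->|->] := unliftP ord0 k.
  by rewrite consrS !mxE liftK /= (inj_eq (@lift_inj _ _)).
by rewrite consr0 !mxE unlift_none /= mulr0 add0r.
Qed.

Lemma consr_cvg n (a b : R) (y z : 'rV[R]_n) :
  `|consr a y - consr b z| <= Num.max `|a - b| `|y - z|.
Proof.
rewrite [leLHS]/Num.Def.normr/= mx_normrE bigmax_le ?le_max ?normr_ge0//= => -[i k] _.
rewrite !mxE /=; case: unliftP => [j _|_] /=.
  rewrite le_max; apply/orP; right.
  rewrite [leRHS]/Num.Def.normr/= mx_normrE.
  by apply: le_trans (le_bigmax _ _ (0, j)); rewrite !mxE.
by rewrite le_max lexx.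
Qed.

Lemma near_dist_lt (V : normedModType R) (y : V) (e : R) : 0 < e ->
  \forall z \near y, `|y - z| < e.
Proof. by move=> e0; apply/nbhs_normP; exists e. Qed.

Lemma continuous_consrl n (y : 'rV[R]_n) : continuous (fun a => consr a y).
Proof.
move=> a; apply/cvgrPdist_lt => e e0; near=> b.
rewrite (le_lt_trans (consr_cvg _ _ _ _))// subrr normr0 gt_max e0 andbT.
by near: b; exact: (@near_dist_lt R^o a e e0).
Unshelve. all: by end_near. Qed.

Lemma continuous_consrr n (a : R) : continuous (@consr n a).
Proof.
move=> y; apply/(@cvgrPdist_lt R 'rV[R]_n.+1 'rV[R]_n (nbhs y)) => e e0; near=> b.
rewrite (le_lt_trans (consr_cvg _ _ _ _))// subrr normr0 gt_max e0 andTb.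
by near: b; exact: (@near_dist_lt _ y e e0).
Unshelve. all: by end_near. Qed.

Lemma near_row_norm_gt n (x : 'rV[R]_n) i (M : R) : M < `|x 0 i| ->
  \forall y \near nbhs x, M < `|(y : 'rV[R]_n) 0 i|.
Proof.
move=> Mx; have := @coord_continuous R 1 n 0 i x.
move=> /cvg_norm /cvgr_gt; exact.
Qed.

(** Off the closed box that bounds the support, [f] vanishes on a neighbourhood, so its derivative
    vanishes too and the same bound [M] serves. *)
Lemma Cc_partial n (j : 'I_n) (f : 'rV[R]_n -> R) : Cc f ->
  continuous (partial j f) -> Cc (partial j f).
Proof.
move=> [_ [M hM]] cf; split=> //; exists M => x pf i; rewrite leNgt.
apply/negP => /near_row_norm_gt Mx; move/eqP: pf; apply.
have f0 : \forall y \near x, f y = cst 0 y.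
  near=> y; apply: contrapT => /eqP/hM/(_ i); apply/negP; rewrite -ltNge.
  by near: y.
by rewrite /partial (near_eq_derive _ f0) derive_cst.
Unshelve. all: by end_near. Qed.

Lemma Rint_derive_compact (F f : R -> R) (M : R) :
  (forall x : R, is_derive x 1 F (f x)) -> continuous f ->
  (forall x, M < `|x| -> F x = 0) -> (forall x, M < `|x| -> f x = 0) ->
  (\int[lebesgue_measure]_x (f x)%:E = 0)%E.
Proof.
move=> dF cf F0 f0; pose K := `|M| + 1.
have MK : M < K by rewrite (le_lt_trans (ler_norm _))// ltrDl.
have K0 : 0 < K by rewrite ltr_pwDr.
have cF : continuous F.
  by move=> x; apply: differentiable_continuous; apply/derivable1_diffP; case: (dF x).
have -> : (fun x => (f x)%:E) = (EFin \o f) \_ `[- K, K]%classic.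
  apply/funext => x; rewrite patchE; case: ifPn => //; rewrite notin_setE /=.
  rewrite in_itv/= -ler_norml => /negP; rewrite -ltNge => Kx.
  by rewrite f0// (lt_trans MK).
rewrite -integral_mkcond (@continuous_FTC2 _ _ F)//.
- by rewrite (F0 K) ?(F0 (- K)) ?subee ?normrN ?gtr0_norm.
- by rewrite -subr_gt0 opprK addr_gt0.
- exact: continuous_subspaceT.
- split.
  + by move=> x _; case: (dF x).
  + by apply: cvg_at_right_filter; exact: cF.
  + by apply: cvg_at_left_filter; exact: cF.
- by move=> x _; rewrite derive1E; case: (dF x).
Qed.

Lemma derivable_consrl n (f : 'rV[R]_n.+1 -> R) y (x : R) :
  derivable f (consr x y) (delta_mx 0 ord0) ->
  is_derive x 1 (fun a => f (consr a y)) (partial ord0 f (consr x y)).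
Proof.
move=> df.
have e : (fun h : R => h^-1 *: ((f \o shift (consr x y)) (h *: delta_mx 0 ord0)
    - f (consr x y))) =
  (fun h : R => h^-1 *: (((fun a => f (consr a y)) \o shift x) (h *: 1)
    - f (consr x y))).
  by apply/funext => h /=; rewrite consrDl /GRing.scale /= mulr1.
by split; rewrite /derivable /partial /derive -e.
Qed.

Lemma derivable_consrr n (f : 'rV[R]_n.+1 -> R) x (y : 'rV[R]_n) i :
  derivable f (consr x y) (delta_mx 0 (lift ord0 i)) ->
  is_derive y (delta_mx 0 i) (f \o consr x) (partial (lift ord0 i) f (consr x y)).
Proof.
move=> df.
have e : (fun h : R => h^-1 *: ((f \o shift (consr x y))
     (h *: delta_mx 0 (lift ord0 i)) - f (consr x y))) =
  (fun h : R => h^-1 *: (((f \o consr x) \o shift y) (h *: delta_mx 0 i)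
    - f (consr x y))).
  by apply/funext => h /=; rewrite consrDr.
by split; rewrite /derivable /partial /derive -e.
Qed.

Lemma Cc_consrr n (f : 'rV[R]_n.+1 -> R) x : Cc f -> Cc (f \o @consr n x).
Proof.
move=> [cf [M hM]]; split.
  by move=> y; apply: continuous_comp; [exact: continuous_consrr|exact: cf].
by exists M => y /hM h i; have := h (lift ord0 i); rewrite consrS.
Qed.

(** Fubini on R * R^n, with the order of integration dictated by [j]: a derivative in a tail
    coordinate is killed by the induction hypothesis on each slice, a derivative in the head
    coordinate by the fundamental theorem of calculus on each line. *)
Lemma Int_partial n (j : 'I_n) (f : 'rV[R]_n -> R) : Cc f ->
  (forall x, derivable f x (delta_mx 0 j)) -> continuous (partial j f) ->
  Int (partial j f) = 0.
Proof.
elim: n j f => [[]//|n IH] j f ccf df cpf.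
have cp := Cc_partial ccf cpf.
apply: EFin_inj; rewrite -IntE//.
have mg := measurable_continuous_row cpf.
pose G : n.+1.-tuple (measurableTypeR R) -> \bar R :=
  EFin \o (partial j f \o @row_of R n.+1).
have mG : measurable_fun setT G by apply/measurable_EFinP.
pose P := (@lebesgue_measure R \x lebesgue_tuple R n)%E.
have iG : P.-integrable setT (G \o @tuple_cons R n).
  apply/integrableP; split.
    by apply: measurableT_comp => //; exact: measurable_tuple_cons.
  have /integrableP[_] := Cc_integrable cp.
  apply: le_lt_trans; rewrite /= /push_cons.
  rewrite (ge0_integral_pushforward (@measurable_tuple_cons R n))//.
  apply/measurable_EFinP.
  by apply: measurableT_comp mg.
have -> : (\int[lebesgue_tuple R n.+1]_t (partial j f (row_of t))%:E =
   \int[P]_z (G \o @tuple_cons R n) z)%E.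
  rewrite /= /push_cons.
  by rewrite (integral_pushforward (@measurable_tuple_cons R n)).
have [i ji|j0] := unliftP ord0 j.
  rewrite -integral12_prod_meas1//= /fubini_F integral0_eq// => x _ /=.
  under eq_integral do rewrite /G /= row_of_cons /=.
  have e : partial i (f \o consr x) = partial j f \o consr x.
    apply/funext => y; rewrite ji; have := @derivable_consrr n f x y i.
    by rewrite -ji => /(_ (df _)) d; rewrite /partial derive_val.
  transitivity ((Int (partial i (f \o consr x)))%:E).
    by rewrite -IntE e //; exact: Cc_consrr.
  rewrite IH //; first exact: Cc_consrr.
    by move=> y; have [] := @derivable_consrr n f x y i; rewrite -?ji.
  by rewrite e; case: (Cc_consrr x cp).
(* Case j = 0: the head coordinate becomes the inner variable. *)
rewrite -integral21_prod_meas1//= /fubini_G integral0_eq// => t _ /=.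
under eq_integral do rewrite /G /= row_of_cons /=.
have [M hM] := ccf.2; have [M' hM'] := cp.2.
apply: (@Rint_derive_compact (fun a => f (consr a (row_of t))) _ (Num.max M M')).
- by move=> x; rewrite j0; apply: derivable_consrl; rewrite -j0.
- move=> x; apply: continuous_comp; [exact: continuous_consrl|exact: cpf].
- move=> x; rewrite gt_max => /andP[Mx _]; apply: contrapT => /eqP/hM/(_ ord0).
  by rewrite consr0 leNgt Mx.
- move=> x; rewrite gt_max => /andP[_ Mx]; apply: contrapT => /eqP/hM'/(_ ord0).
  by rewrite consr0 leNgt Mx.
Qed.

End divergence.

(** * Smooth functions *)

Section smoothness.
Context {R : realType} {n : nat}.
Implicit Types f g : 'rV[R]_n -> R.

Notation e_ i := (delta_mx 0 i : 'rV[R]_n).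

(** Finite-order form of [smooth], by recursion on the order: unlike a quantification over lists of
    indices, it lends itself to induction for sums and products. *)
Fixpoint Ck (k : nat) f : Prop :=
  if k is k'.+1 then
    [/\ continuous f, forall x i, derivable f x (e_ i) &
        forall i, Ck k' (partial i f)]
  else continuous f.

Lemma Ck_continuous k f : Ck k f -> continuous f.
Proof. by case: k => [|k] // []. Qed.

Lemma CkW k f : Ck k.+1 f -> Ck k f.
Proof.
elim: k f => [|k IH] f; first by case.
by move=> [cf df pf]; split=> // i; apply: IH; exact: pf.
Qed.

Lemma smooth_Ck f : smooth f -> forall k, Ck k f.
Proof.
move=> sf k; elim: k f sf => [|k IH] f sf /=; first by have [] := sf [::].
split; [by have [] := sf [::]|by have [] := sf [::]|move=> i; apply: IH => s].
(* [foldr] applies the last index of the list first, so the derivative peeled off by [Ck] sits at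
   the end. *)
by have := sf (rcons s i); rewrite foldr_rcons.
Qed.

Lemma Ck_smooth f : (forall k, Ck k f) -> smooth f.
Proof.
move=> cf s; elim/last_ind: s f cf => [|s i IH] f cf /=.
  by have [] := cf 1%N.
by rewrite foldr_rcons; apply: IH => k; have [_ _] := cf k.+1; exact.
Qed.

Lemma is_derive_partial f x i : derivable f x (e_ i) ->
  is_derive x (e_ i) f (partial i f x).
Proof. exact: derivableP. Qed.

Lemma partial_val i f x d : is_derive x (e_ i) f d -> partial i f x = d.
Proof. by move=> df; rewrite /partial derive_val. Qed.

Lemma CkD k f g : Ck k f -> Ck k g -> Ck k (fun x => f x + g x).
Proof.
elim: k f g => [|k IH] f g; first by move=> cf cg x; exact: (cvgD (cf x) (cg x)).
move=> [cf df pf] [cg dg pg].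
have d x i : is_derive x (e_ i) (fun x => f x + g x) (partial i f x + partial i g x).
  by apply: is_deriveD; exact: is_derive_partial.
split; [by move=> x; exact: (cvgD (cf x) (cg x))| |move=> i].
  by move=> x i; exact: (@ex_derive _ _ _ _ _ _ _ (d x i)).
rewrite (_ : partial i _ = fun x => partial i f x + partial i g x).
  exact: (IH _ _ (pf i) (pg i)).
by apply/funext => x; exact: partial_val.
Qed.

Lemma CkM k f g : Ck k f -> Ck k g -> Ck k (fun x => f x * g x).
Proof.
elim: k f g => [|k IH] f g; first by move=> cf cg x; exact: (cvgM (cf x) (cg x)).
move=> cf' cg'; have [cf df pf] := cf'; have [cg dg pg] := cg'.
have d x i : is_derive x (e_ i) (fun x => f x * g x)
    (f x * partial i g x + g x * partial i f x).
  have := is_deriveM (is_derive_partial (df x i)) (is_derive_partial (dg x i)).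
  exact.
split; [by move=> x; exact: (cvgM (cf x) (cg x))| |move=> i].
  by move=> x i; exact: (@ex_derive _ _ _ _ _ _ _ (d x i)).
rewrite (_ : partial i _ = fun x => f x * partial i g x + g x * partial i f x).
  by apply: CkD; apply: IH => //; (exact: pf || exact: pg || exact: CkW).
by apply/funext => x; exact: partial_val.
Qed.

Lemma Ck_cst k (c : R) : Ck k (fun=> c).
Proof.
elim: k c => [|k IH] c /=; first exact: cst_continuous.
split; [exact: cst_continuous|by move=> *; exact: derivable_cst|move=> i].
rewrite (_ : partial i _ = fun=> 0) //.
by apply/funext => x; rewrite /partial derive_cst.
Qed.

Lemma is_derive_coord (x : 'rV[R]_n) i (j : 'I_n) :
  is_derive x (e_ i) (fun y : 'rV[R]_n => y 0 j) (j == i)%:R.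
Proof.
have d : derivable (@id 'rV[R]_n) x (e_ i) by exact: derivable_id.
split; first by move/derivable_mxP : (d); exact.
have := congr1 (fun M : 'rV[R]_n => M 0 j) (derive_mx d).
by rewrite derive_id !mxE /= => <-.
Qed.

Lemma Ck_coord k (j : 'I_n) : Ck k (fun x : 'rV[R]_n => x 0 j).
Proof.
case: k => [|k] /=; first exact: coord_continuous.
split; first exact: coord_continuous.
  by move=> x i; case: (is_derive_coord x i j).
move=> i; rewrite (_ : partial i _ = fun=> (j == i)%:R); first exact: Ck_cst.
by apply/funext => x; exact: (partial_val (is_derive_coord x i j)).
Qed.

Lemma Ck_sum k (I : Type) (s : seq I) (f : I -> 'rV[R]_n -> R) :
  (forall i, Ck k (f i)) -> Ck k (fun x => \sum_(i <- s) f i x).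
Proof.
move=> cf; elim: s => [|i s IH].
  have -> : (fun x => \sum_(i <- [::]) f i x) = fun=> 0.
    by apply/funext => x; rewrite big_nil.
  exact: Ck_cst.
have -> : (fun x => \sum_(j <- i :: s) f j x) =
    fun x => f i x + \sum_(j <- s) f j x.
  by apply/funext => x; rewrite big_cons.
exact: CkD.
Qed.

End smoothness.

(** * Calculus in the unit ball *)

Section directional_derivatives.
Context {R : realType} {V : normedModType R}.
Implicit Types (f g : V -> R) (x v : V).

Lemma der_add f g x v df dg : is_derive x v f df -> is_derive x v g dg ->
  is_derive x v (fun y => f y + g y) (df + dg).
Proof. by move=> hf hg; exact: is_deriveD. Qed.

Lemma der_mul f g x v df dg : is_derive x v f df -> is_derive x v g dg ->
  is_derive x v (fun y => f y * g y) (f x * dg + g x * df).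
Proof. by move=> hf hg; exact: is_deriveM. Qed.

Lemma der_cst (c : R) x v : is_derive x v (fun=> c) 0.
Proof. exact: is_derive_cst. Qed.

Lemma der_scale c f x v df : is_derive x v f df ->
  is_derive x v (fun y => c * f y) (c * df).
Proof.
move=> hf; apply: is_derive_eq (der_mul (der_cst c x v) hf) _.
by rewrite mulr0 addr0.
Qed.

Lemma der_opp f x v df : is_derive x v f df ->
  is_derive x v (fun y => - f y) (- df).
Proof. by move=> hf; exact: is_deriveN. Qed.

Lemma der_sum (I : Type) (s : seq I) (f : I -> V -> R) (df : I -> R) x v :
  (forall i, is_derive x v (f i) (df i)) ->
  is_derive x v (fun y => \sum_(i <- s) f i y) (\sum_(i <- s) df i).
Proof.
move=> hf; elim: s => [|i s IH].
  have -> : (fun x => \sum_(i <- [::]) f i x) = fun=> 0.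
    by apply/funext => y; rewrite big_nil.
  by rewrite big_nil; exact: der_cst.
have -> : (fun x => \sum_(j <- i :: s) f j x) =
    fun x => f i x + \sum_(j <- s) f j x.
  by apply/funext => y; rewrite big_cons.
by rewrite big_cons; exact: der_add.
Qed.

(** Turns a directional derivative into an ordinary one at 0, so that [der_chain] follows from the
    one-variable chain rule and asks for no Frechet differentiability of the inner function. *)
Lemma derive_line f x v :
  'D_1 (fun h : R => f (h *: v + x)) (0 : R) = 'D_v f x.
Proof.
have e : (fun h : R => h^-1 *: (((fun h : R => f (h *: v + x)) \o shift 0)
     (h *: 1) - f ((0 : R) *: v + x))) =
   (fun h : R => h^-1 *: ((f \o shift x) (h *: v) - f x)).
  by apply/funext => h /=; rewrite addr0 scale0r add0r [_%:A]mulr1.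
by rewrite /derive e.
Qed.

Lemma der_chain f (G : R -> R) x v df dG : is_derive x v f df ->
  is_derive (f x) 1 G dG -> is_derive x v (fun y => G (f y)) (dG * df).
Proof.
move=> [fx <-] hG.
have d1 : is_derive (0 : R) 1 (fun h : R => f (h *: v + x)) ('D_v f x).
  split; first exact: (@derivable1P R V R^o f x v).1 fx.
  exact: derive_line.
have hG' : is_derive (f (0 *: v + x)) 1 G dG by rewrite scale0r add0r.
have [e1 e2] := is_derive1_comp hG' d1.
split; first exact: (@derivable1P R V R^o (fun y => G (f y)) x v).2 e1.
by rewrite -e2 -derive_line.
Qed.

Lemma der_inv f x v df : is_derive x v f df -> f x != 0 ->
  is_derive x v (fun y => (f y)^-1) (- (f x) ^- 2 * df).
Proof.
move=> [hf <-] fx; split; first exact: derivableV.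
exact: (deriveV fx hf).
Qed.

Lemma der_exp f x v df k : is_derive x v f df ->
  is_derive x v (fun y => f y ^+ k) (k%:R * f x ^+ k.-1 * df).
Proof.
move=> hf; elim: k => [|k IH].
  by rewrite !mul0r; exact: der_cst.
have -> : (fun y => f y ^+ k.+1) = fun y => f y * f y ^+ k.
  by apply/funext => y; rewrite exprS.
apply: is_derive_eq (der_mul hf IH) _.
case: k {IH} => [|k] /=; first by rewrite expr0; ring.
by rewrite -[k.+2%:R]natr1 exprS; ring.
Qed.

Lemma der_sqr f x v df : is_derive x v f df ->
  is_derive x v (fun y => f y ^+ 2) (2 * f x * df).
Proof. by move=> hf; exact: (der_exp 2 hf). Qed.

End directional_derivatives.

(** * The conformal factor of the ball, and functions vanishing near its complement *)

Section ball.
Context {R : realType} {N : nat}.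
Implicit Types f g : 'rV[R]_N -> R.

Notation e_ i := (delta_mx 0 i : 'rV[R]_N).
Notation hyp := (@hyp_space R N).
Notation N' := (N%:R : R).

(** The metric is eta^-2 |dx|^2: this is the inverse of the conformal factor, and [dens] below is
    the volume density on the ball. *)
Definition eta (x : 'rV[R]_N) : R := (1 - euclid_sqnorm x) / 2.
Definition dens (x : 'rV[R]_N) : R := (eta x)^-1 ^+ N.

Lemma Ck_sqnorm k : Ck k (@euclid_sqnorm R N).
Proof. by apply: Ck_sum => i; apply: CkM; exact: Ck_coord. Qed.

Lemma Ck_eta k : Ck k eta.
Proof.
apply: CkM; last exact: Ck_cst.
apply: CkD; first exact: Ck_cst.
rewrite (_ : (fun x => _) = fun x => -1 * @euclid_sqnorm R N x).
  by apply: CkM; [exact: Ck_cst|exact: Ck_sqnorm].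
by apply/funext => x; rewrite mulN1r.
Qed.

Lemma hyp_near x : hyp x -> \forall y \near x, hyp y.
Proof.
move=> hx; have := Ck_continuous (Ck_sqnorm 0) (x := x).
by move=> /cvgr_lt; apply.
Qed.

Lemma eta_gt0 x : hyp x -> 0 < eta x.
Proof. by rewrite /hyp_space /= => h; rewrite divr_gt0// subr_gt0. Qed.

Lemma dens_gt0 x : hyp x -> 0 < dens x.
Proof. by move=> /eta_gt0 h; rewrite exprn_gt0// invr_gt0. Qed.

Lemma hyp_coord x i : hyp x -> `|x 0 i| <= 1.
Proof.
rewrite /hyp_space /= => h; rewrite -ler_sqr ?nnegrE//.
rewrite real_normK ?num_real// expr1n (le_trans _ (ltW h))//.
rewrite /euclid_sqnorm (bigD1 i)//= lerDl sumr_ge0// => j _; exact: sqr_ge0.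
Qed.

Lemma der_sqnorm x j : is_derive x (e_ j) (@euclid_sqnorm R N) (2 * x 0 j).
Proof.
apply: is_derive_eq.
  by apply: der_sum => i; apply: der_sqr; exact: is_derive_coord.
rewrite (bigD1 j)//= eqxx mulr1 big1 ?addr0// => i /negbTE ->.
by rewrite mulr0.
Qed.

Lemma der_eta x j : is_derive x (e_ j) eta (- x 0 j).
Proof.
have h := der_mul (der_add (der_cst 1 x (e_ j)) (der_opp (der_sqnorm x j)))
  (der_cst 2^-1 x (e_ j)).
by apply: (is_derive_eq h); field.
Qed.

Lemma der_etaV x j : hyp x ->
  is_derive x (e_ j) (fun x => (eta x)^-1) ((eta x) ^- 2 * x 0 j).
Proof.
move=> hx; have h0 : eta x != 0 by rewrite gt_eqF// eta_gt0.
by apply: (is_derive_eq (der_inv (der_eta x j) h0)); rewrite mulrNN.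
Qed.

Lemma der_dens x j : hyp x ->
  is_derive x (e_ j) dens (N' * dens x * (eta x)^-1 * x 0 j).
Proof.
move=> hx; apply: (is_derive_eq (der_exp N (der_etaV j hx))).
have e (a : R) : N' * a ^+ N.-1 * a = N' * a ^+ N.
  by case: (N) => [|k]; rewrite ?mul0r // -mulrA -exprSr.
by rewrite /dens -(e (eta x)^-1) -exprVn; ring.
Qed.

(** Vanishing on a neighbourhood of each point outside the ball (boundary sphere included) survives
    multiplication by arbitrary functions. Paired with [contB] it yields global continuity of
    products whose factors, such as powers of 1/eta, are controlled on the ball only. *)
Definition supp0 f := forall x, ~ hyp x -> \forall y \near x, f y = 0.
Definition contB f := forall x, hyp x -> {for x, continuous f}.

Lemma supp0_continuous f : supp0 f -> contB f -> continuous f.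
Proof.
move=> sf cf x; have [hx|/sf fx] := pselect (hyp x); first exact: cf.
have fx0 : f x = 0 by exact: nbhs_singleton fx.
rewrite /continuous_at fx0.
exact: (@cvg_near_cst _ _ 0 f (nbhs x) (nbhs_filter x) fx).
Qed.

Lemma supp0_0 f x : supp0 f -> ~ hyp x -> f x = 0.
Proof. by move=> sf /sf; exact: nbhs_singleton. Qed.

Lemma supp0_Cc f : supp0 f -> contB f -> Cc f.
Proof.
move=> sf cf; split; first exact: supp0_continuous.
exists 1 => x fx i; apply: hyp_coord; apply: contrapT => /(supp0_0 sf) f0.
by move: fx; rewrite f0 eqxx.
Qed.

Lemma supp0_mulr f g : supp0 f -> supp0 (fun x => f x * g x).
Proof. by move=> sf x /sf; apply: filterS => y ->; rewrite mul0r. Qed.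

Lemma supp0_mull f g : supp0 g -> supp0 (fun x => f x * g x).
Proof. by move=> sf x /sf; apply: filterS => y ->; rewrite mulr0. Qed.

Lemma supp0_add f g : supp0 f -> supp0 g -> supp0 (fun x => f x + g x).
Proof.
by move=> sf sg x hx; apply: filterS2 (sf _ hx) (sg _ hx) => y -> ->; rewrite addr0.
Qed.

Lemma supp0_sum (I : Type) (s : seq I) (f : I -> 'rV[R]_N -> R) :
  (forall i, supp0 (f i)) -> supp0 (fun x => \sum_(i <- s) f i x).
Proof.
move=> sf; elim: s => [|i s IH] x hx.
  by near=> y; rewrite big_nil.
by apply: filterS2 (sf i _ hx) (IH _ hx) => y; rewrite big_cons => -> ->; rewrite addr0.
Unshelve. all: by end_near. Qed.

Lemma supp0_partial f j : supp0 f -> supp0 (partial j f).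
Proof.
move=> sf x /sf fx; have := near_join fx; apply: filterS => y fy.
have f0 : \forall y0 \near y, f y0 = cst 0 y0 by [].
by rewrite /partial (near_eq_derive _ f0) derive_cst.
Qed.

Lemma contB_add f g : contB f -> contB g -> contB (fun x => f x + g x).
Proof. by move=> cf cg x hx; exact: (cvgD (cf x hx) (cg x hx)). Qed.

Lemma contB_mul f g : contB f -> contB g -> contB (fun x => f x * g x).
Proof. by move=> cf cg x hx; exact: (cvgM (cf x hx) (cg x hx)). Qed.

Lemma contB_cst (c : R) : contB (fun=> c).
Proof. by move=> x _; exact: cst_continuous. Qed.

Lemma contB_opp f : contB f -> contB (fun x => - f x).
Proof. by move=> cf x hx; exact: (cvgN (cf x hx)). Qed.

Lemma contB_exp f k : contB f -> contB (fun x => f x ^+ k).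
Proof.
move=> cf; elim: k => [|k IH]; first exact: contB_cst.
have -> : (fun x => f x ^+ k.+1) = fun x => f x * f x ^+ k.
  by apply/funext => x; rewrite exprS.
exact: contB_mul.
Qed.

Lemma contB_inv f : contB f -> (forall x, hyp x -> f x != 0) ->
  contB (fun x => (f x)^-1).
Proof. by move=> cf f0 x hx; exact: (cvgV (f0 x hx) (cf x hx)). Qed.

Lemma contB_sum (I : Type) (s : seq I) (f : I -> 'rV[R]_N -> R) :
  (forall i, contB (f i)) -> contB (fun x => \sum_(i <- s) f i x).
Proof.
move=> cf; elim: s => [|i s IH].
  have -> : (fun x => \sum_(i <- [::]) f i x) = fun=> 0.
    by apply/funext => x; rewrite big_nil.
  exact: contB_cst.
have -> : (fun x => \sum_(j <- i :: s) f j x) =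
    fun x => f i x + \sum_(j <- s) f j x.
  by apply/funext => x; rewrite big_cons.
exact: contB_add.
Qed.

Lemma contB_comp f (G : R -> R) : contB f ->
  (forall x, hyp x -> {for f x, continuous G}) -> contB (fun x => G (f x)).
Proof.
by move=> cf cG x hx; apply: continuous_comp; [exact: cf|exact: cG].
Qed.

Lemma contB_cont f : continuous f -> contB f.
Proof. by move=> cf x _; exact: cf. Qed.

Lemma contB_eta : contB eta.
Proof. exact: contB_cont (Ck_continuous (Ck_eta 0)). Qed.

Lemma contB_coord i : contB (fun x : 'rV[R]_N => x 0 i).
Proof. by apply: contB_cont; exact: coord_continuous. Qed.

Lemma contB_etaV : contB (fun x => (eta x)^-1).
Proof.
by apply: contB_inv; [exact: contB_eta|move=> x /eta_gt0 h; rewrite gt_eqF].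
Qed.

Lemma contB_dens : contB dens.
Proof. by apply: contB_exp; exact: contB_etaV. Qed.

End ball.

(** * The hyperbolic Laplacian and the divergence theorem *)

Section laplacian.
Context {R : realType} {N : nat}.
Implicit Types u f g : 'rV[R]_N -> R.

Notation e_ i := (delta_mx 0 i : 'rV[R]_N).
Notation hyp := (@hyp_space R N).
Notation N' := (N%:R : R).

Definition hint f : R := Int (fun x => f x * dens x).

(** The expansion of eta^N sum_j d_j (eta^(2-N) d_j psi). The derivatives are passed as families of
    functions so that explicit formulas, valid on the ball only, can replace [partial]. *)
Definition lapl_of (d1 d2 : 'I_N -> 'rV[R]_N -> R) (x : 'rV[R]_N) : R :=
  eta x ^+ 2 * (\sum_j d2 j x) + (N' - 2) * eta x * \sum_j x 0 j * d1 j x.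

Definition inner (d1 d2 : 'I_N -> 'rV[R]_N -> R) (x : 'rV[R]_N) : R :=
  eta x ^+ 2 * \sum_j d1 j x * d2 j x.

Lemma green_field (p d1 d2 : 'rV[R]_N -> R) (dp : 'rV[R]_N -> R) j x : hyp x ->
  is_derive x (e_ j) p (dp x) -> is_derive x (e_ j) d1 (d2 x) ->
  is_derive x (e_ j) (fun x => p x * (dens x * (eta x ^+ 2 * d1 x)))
   (dens x * (p x * (eta x ^+ 2 * d2 x + (N' - 2) * eta x * (x 0 j * d1 x))
      + eta x ^+ 2 * (dp x * d1 x))).
Proof.
move=> hx hp h1.
have h := der_mul hp (der_mul (der_dens j hx) (der_mul (der_sqr (der_eta x j)) h1)).
apply: (is_derive_eq h).
have h0 : eta x != 0 by rewrite gt_eqF// eta_gt0.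
by field.
Qed.

(* Divergence theorem for the field p grad(psi), where d1 and d2 are the first
   and second pure derivatives of psi in the coordinate directions. *)
Lemma green (p : 'rV[R]_N -> R) (dp d1 d2 : 'I_N -> 'rV[R]_N -> R) :
  (forall x j, hyp x -> is_derive x (e_ j) p (dp j x)) ->
  contB p -> (forall j, contB (dp j)) -> supp0 p -> (forall j, supp0 (dp j)) ->
  (forall x j, hyp x -> is_derive x (e_ j) (d1 j) (d2 j x)) ->
  (forall j, contB (d1 j)) -> (forall j, contB (d2 j)) ->
  hint (fun x => p x * lapl_of d1 d2 x + inner dp d1 x) = 0.
Proof.
move=> hp cp cdp sp sdp h1 c1 c2.
(* The j-th component of p |g|^(1/2) grad psi, and below it the candidate [G j] for its j-th
   derivative. *)
pose F j (x : 'rV[R]_N) := p x * (dens x * (eta x ^+ 2 * d1 j x)).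
pose G j (x : 'rV[R]_N) :=
  dens x * (p x * (eta x ^+ 2 * d2 j x + (N' - 2) * eta x * (x 0 j * d1 j x))
      + eta x ^+ 2 * (dp j x * d1 j x)).
have sF j : supp0 (F j) by exact: supp0_mulr.
have cF j : contB (F j).
  apply: contB_mul => //; apply: contB_mul; first exact: contB_dens.
  by apply: contB_mul => //; apply: contB_exp; exact: contB_eta.
have sG j : supp0 (G j).
  apply: supp0_mull; apply: supp0_add; first exact: supp0_mulr.
  by apply: supp0_mull; exact: supp0_mulr.
have ce := @contB_eta R N; have cd := @contB_dens R N.
have cG j : contB (G j).
  apply: contB_mul => //; apply: contB_add.
    apply: contB_mul => //; apply: contB_add.
      by apply: contB_mul => //; exact: contB_exp.
    apply: contB_mul; last by apply: contB_mul => //; exact: contB_coord.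
    by apply: contB_mul => //; exact: contB_cst.
  by apply: contB_mul; [exact: contB_exp|exact: contB_mul].
have dF x j : is_derive x (e_ j) (F j) (G j x).
  have [hx|hx] := pselect (hyp x).
    by apply: green_field => //; [exact: hp|exact: h1].
  (* Outside the ball nothing is known about [p] or [d1], but the flux vanishes on a
     neighbourhood. *)
  rewrite (supp0_0 (sG j) hx).
  have f0 : \forall y \near x, cst 0 y = F j y.
    by have := sF j x hx; apply: filterS => y ->.
  exact: (near_eq_is_derive f0 (der_cst 0 x (e_ j))).
have pF j : partial j (F j) = G j by apply/funext => x; exact: partial_val.
rewrite /hint (_ : (fun _ => _) = fun x => \sum_j G j x).
  rewrite Int_sum; last by move=> j; exact: supp0_Cc.
  rewrite big1 // => j _; rewrite -pF; apply: Int_partial.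
  - exact: supp0_Cc.
  - by move=> x; exact: (@ex_derive _ _ _ _ _ _ _ (dF x j)).
  - by rewrite pF; exact: supp0_continuous.
apply/funext => x; rewrite /G -mulr_sumr mulrC; congr (_ * _).
rewrite big_split /= -mulr_sumr big_split /= -!mulr_sumr.
by rewrite /lapl_of /inner.
Qed.

Lemma hyp_metricE (x : 'rV[R]_N) : hyp_metric x = ((eta x)^-1 ^+ 2)%:M.
Proof. by rewrite /hyp_metric /eta invf_div. Qed.

Lemma vol_densityE x : hyp x -> vol_density (@hyp_metric R N) x = dens x.
Proof.
move=> hx; rewrite /vol_density hyp_metricE det_scalar.
by rewrite -exprM mulnC exprM sqrtr_sqr ger0_norm// ltW// dens_gt0.
Qed.

Lemma gradE u x j : grad (@hyp_metric R N) u x 0 j = eta x ^+ 2 * partial j u x.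
Proof.
rewrite /grad hyp_metricE invmx_scalar mul_mx_scalar !mxE.
by rewrite -exprVn invrK.
Qed.

Lemma hyp_grad_sqnormE u x : hyp x ->
  hyp_grad_sqnorm u x = inner (fun j => partial j u) (fun j => partial j u) x.
Proof.
move=> hx; rewrite /hyp_grad_sqnorm /metric_sqnorm hyp_metricE mul_mx_scalar.
have -> : grad (@hyp_metric R N) u x = \row_j (eta x ^+ 2 * partial j u x).
  by apply/rowP => j; rewrite gradE mxE.
rewrite -scalemxAl !mxE /inner !mulr_sumr.
have h0 : eta x != 0 by rewrite gt_eqF// eta_gt0.
by apply: eq_bigr => j _; rewrite !mxE; field.
Qed.

Definition lapl u : 'rV[R]_N -> R :=
  lapl_of (fun j => partial j u) (fun j => partial j (partial j u)).

Notation tf := (test_function hyp).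

Lemma tf_Ck u k : tf u -> Ck k u.
Proof. by case=> /smooth_Ck. Qed.

Lemma tf_near0 u x : tf u -> ~ closure [set x | u x != 0] x ->
  \forall y \near x, u y = 0.
Proof.
move=> _ hx.
have : open (~` closure [set x | u x != 0]) by rewrite openC; exact: closed_closure.
rewrite openE => /(_ x hx); rewrite /interior.
apply: filterS => y hy; apply: contrapT => /eqP uy; apply: hy.
exact: subset_closure.
Qed.

Lemma tf_supp0 u : tf u -> supp0 u.
Proof.
move=> tu x hx; apply: tf_near0 => // cx; apply: hx.
by case: tu => _ _; apply.
Qed.

Lemma lapl_near0 u x : (\forall y \near x, u y = 0) -> lapl u x = 0.
Proof.
move=> u0.
have p0 j : \forall y \near x, partial j u y = 0.
  have := near_join u0; apply: filterS => y fy.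
  have f0 : \forall y0 \near y, u y0 = cst 0 y0 by [].
  by rewrite /partial (near_eq_derive _ f0) derive_cst.
have pp0 j : partial j (partial j u) x = 0.
  have f0 : \forall y \near x, partial j u y = cst 0 y by exact: p0.
  by rewrite {1}/partial (near_eq_derive _ f0) derive_cst.
rewrite /lapl /lapl_of !big1 ?mulr0 ?addr0// => j _ /=.
by rewrite (nbhs_singleton (p0 j)) mulr0.
Qed.

Lemma Ck_lapl u : tf u -> forall k, Ck k (lapl u).
Proof.
move=> tu k; have := tf_Ck k.+2 tu; case=> _ _ p1.
apply: CkD; apply: CkM.
- by apply: CkM; exact: Ck_eta.
- by apply: Ck_sum => j; have [_ _] := p1 j; exact.
- by apply: CkM; [exact: Ck_cst|exact: Ck_eta].
- by apply: Ck_sum => j; apply: CkM; [exact: Ck_coord|apply: CkW; exact: p1].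
Qed.

Lemma tf_lapl u : tf u -> tf (lapl u).
Proof.
move=> tu; have sub : closure [set x | lapl u x != 0] `<=` closure [set x | u x != 0].
  rewrite closureE; apply: smallest_sub; first exact: closed_closure.
  move=> x /= lx; apply: contrapT => /(tf_near0 tu)/lapl_near0 l0.
  by move: lx; rewrite l0 eqxx.
have [su cu du] := tu; split.
- by apply: Ck_smooth; exact: Ck_lapl.
- by apply: subclosed_compact sub => //; exact: closed_closure.
- exact: subset_trans du.
Qed.

(** The equality is needed on all of R^N, since the iterates are compared as functions. Outside the
    ball both sides vanish because [u] is zero nearby; inside, the formula is the case p = 1 of
    [green_field]. *)
Lemma tf_hyp_laplacian u : tf u -> hyp_laplacian u = lapl u.
Proof.
move=> tu; apply/funext => x; rewrite /hyp_laplacian /laplace_beltrami.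
have [hx|hx] := pselect (hyp x); last first.
  rewrite lapl_near0; last exact: tf_supp0.
  rewrite big1 ?mulr0// => j _; rewrite /partial.
  have u0 : \forall y \near x, vol_density (@hyp_metric R N) y *
     grad (@hyp_metric R N) u y 0 j = cst 0 y.
    have := supp0_partial j (tf_supp0 tu) hx; apply: filterS => y uy.
    by rewrite gradE uy !mulr0.
  by rewrite (near_eq_derive _ u0) derive_cst.
have [cu du pu] := tf_Ck 2 tu.
rewrite vol_densityE//.
have -> : \sum_j partial j (fun y => vol_density (@hyp_metric R N) y *
     grad (@hyp_metric R N) u y 0 j) x = \sum_j (dens x *
  (1 * (eta x ^+ 2 * partial j (partial j u) x +
    (N' - 2) * eta x * (x 0 j * partial j u x)) + eta x ^+ 2 * (0 * partial j u x))).
  apply: eq_bigr => j _; apply: partial_val.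
  have f0 : \forall y \near x, 1 * (dens y * (eta y ^+ 2 * partial j u y)) =
    vol_density (@hyp_metric R N) y * grad (@hyp_metric R N) u y 0 j.
    have := hyp_near hx; apply: filterS => y hy.
    by rewrite vol_densityE// gradE mul1r.
  apply: (near_eq_is_derive f0).
  apply: (@green_field (fun=> 1) (partial j u) (partial j (partial j u)) (fun=> 0)) => //.
  by apply: is_derive_partial; have [_ d2 _] := pu j; exact: d2.
rewrite -mulr_sumr mulKf ?gt_eqF ?dens_gt0// /lapl /lapl_of.
under eq_bigr do rewrite mul1r mul0r mulr0 addr0.
by rewrite big_split /= -!mulr_sumr.
Qed.

Lemma tf_iter u m : tf u -> tf (iter m lapl u).
Proof. by move=> tu; elim: m => [//|m IH]; exact: tf_lapl. Qed.

Lemma iter_hyp_laplacian u m : tf u ->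
  iter m (@hyp_laplacian R N) u = iter m lapl u.
Proof.
move=> tu; elim: m => [//|m IH] /=.
by rewrite IH tf_hyp_laplacian//; exact: tf_iter.
Qed.

(** Integrands for [hint]: they are integrable against [dens], and they absorb any factor that is
    continuous on the ball. *)
Definition nice f := supp0 f /\ contB f.

Lemma nice_Cc f : nice f -> Cc (fun x => f x * dens x).
Proof.
move=> [sf cf]; apply: supp0_Cc; first exact: supp0_mulr.
by apply: contB_mul => //; exact: contB_dens.
Qed.

Lemma niceD f g : nice f -> nice g -> nice (fun x => f x + g x).
Proof. by move=> [? ?] [? ?]; split; [exact: supp0_add|exact: contB_add]. Qed.

Lemma niceMr f g : nice f -> contB g -> nice (fun x => f x * g x).
Proof. by move=> [? ?] ?; split; [exact: supp0_mulr|exact: contB_mul]. Qed.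

Lemma niceMl f g : contB f -> nice g -> nice (fun x => f x * g x).
Proof. by move=> ? [? ?]; split; [exact: supp0_mull|exact: contB_mul]. Qed.

Lemma niceZ c f : nice f -> nice (fun x => c * f x).
Proof. by apply: niceMl; exact: contB_cst. Qed.

Lemma nice_sqr f : nice f -> nice (fun x => f x ^+ 2).
Proof. by move=> nf; apply: niceMr => //; case: nf. Qed.

Lemma nice_sum (f : 'I_N -> 'rV[R]_N -> R) : (forall i, nice (f i)) ->
  nice (fun x => \sum_i f i x).
Proof.
by move=> nf; split; [apply: supp0_sum => i|apply: contB_sum => i]; case: (nf i).
Qed.

Lemma tf_nice u : tf u -> nice u.
Proof.
move=> tu; split; first exact: tf_supp0.
by apply: contB_cont; exact: (Ck_continuous (tf_Ck 0 tu)).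
Qed.

Lemma tf_partial_nice u j : tf u -> nice (partial j u).
Proof.
move=> tu; split; first by apply: supp0_partial; exact: tf_supp0.
by have [_ _ /(_ j) pu] := tf_Ck 1 tu; exact: contB_cont.
Qed.

Lemma tf_partial2_cont u j : tf u -> contB (partial j (partial j u)).
Proof.
by move=> tu; have [_ _ /(_ j) [_ _ /(_ j) pu]] := tf_Ck 2 tu; exact: contB_cont.
Qed.

Lemma tf_der u x j : tf u -> is_derive x (e_ j) u (partial j u x).
Proof.
by move=> tu; have [_ du _] := tf_Ck 1 tu; exact: is_derive_partial.
Qed.

Lemma tf_der2 u x j : tf u ->
  is_derive x (e_ j) (partial j u) (partial j (partial j u) x).
Proof.
by move=> tu; have [_ _ /(_ j) [_ du _]] := tf_Ck 2 tu; exact: is_derive_partial.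
Qed.

Lemma nice_inner d1 d2 : (forall j, nice (d1 j)) -> (forall j, contB (d2 j)) ->
  nice (inner d1 d2).
Proof.
move=> n1 c2; apply: niceMl; first by apply: contB_exp; exact: contB_eta.
by apply: nice_sum => j; exact: niceMr.
Qed.

Lemma hintD f g : nice f -> nice g ->
  hint (fun x => f x + g x) = hint f + hint g.
Proof.
move=> nf ng; rewrite /hint -IntD; [|exact: nice_Cc..].
by congr Int; apply/funext => x; rewrite mulrDl.
Qed.

Lemma hintZ c f : nice f -> hint (fun x => c * f x) = c * hint f.
Proof.
move=> nf; rewrite /hint -IntZ; last exact: nice_Cc.
by congr Int; apply/funext => x; rewrite mulrA.
Qed.

Lemma le_hint f g : nice f -> nice g -> (forall x, hyp x -> f x <= g x) ->
  hint f <= hint g.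
Proof.
move=> nf ng fg; apply: le_Int; [exact: nice_Cc..|move=> x].
have [hx|hx] := pselect (hyp x); first by rewrite ler_pM2r ?dens_gt0 ?fg.
by rewrite (supp0_0 nf.1 hx) (supp0_0 ng.1 hx).
Qed.

Lemma eq_hint f g : nice f -> nice g -> (forall x, hyp x -> f x = g x) ->
  hint f = hint g.
Proof.
by move=> nf ng fg; apply/eqP; rewrite eq_le !le_hint// => x /fg ->.
Qed.

Lemma hyp_integralE f g : nice f -> (forall x, hyp x -> g x = f x) ->
  hyp_integral g = (hint f)%:E.
Proof.
move=> nf gf; rewrite /hyp_integral /riemannian_integral integral_mkcond.
rewrite /hint -(IntE (nice_Cc nf)); apply: eq_integral => t _.
rewrite patchE; case: ifPn => [|]; rewrite ?inE /= ?notin_setE /= => ht.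
  by rewrite gf// vol_densityE.
by rewrite -/(row_of t) (supp0_0 nf.1) ?mul0r.
Qed.

End laplacian.

(** * Radial functions *)

Section arccosh.
Context {R : realType}.
Implicit Types q r : R.

(** sinh (arccosh q); [arc] below is arccosh q, in logarithmic form. *)
Definition sh q : R := Num.sqrt (q ^+ 2 - 1).
Definition arc q : R := ln (q + sh q).

Lemma sqr_gt1 q : 1 < q -> 0 < q ^+ 2 - 1.
Proof. by move=> q1; rewrite subr_gt0 exprn_egt1. Qed.

Lemma sh_gt0 q : 1 < q -> 0 < sh q.
Proof. by move=> q1; rewrite sqrtr_gt0 sqr_gt1. Qed.

Lemma sh_sqr q : 1 < q -> sh q ^+ 2 = q ^+ 2 - 1.
Proof. by move=> q1; rewrite sqr_sqrtr// ltW// sqr_gt1. Qed.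

Lemma der_sh q : 1 < q -> is_derive q 1 sh (q / sh q).
Proof.
move=> q1.
have h : is_derive q 1 (fun q : R => q ^+ 2 - 1) (2 * q * 1 + 0).
  exact: (der_add (der_sqr (is_derive_id q 1)) (der_cst (-1) q 1)).
apply: (is_derive_eq (der_chain h (is_derive1_sqrt (sqr_gt1 q1)))).
have s0 : sh q != 0 by rewrite gt_eqF// sh_gt0.
by rewrite -/(sh q); field.
Qed.

Lemma der_arc q : 1 < q -> is_derive q 1 arc (sh q)^-1.
Proof.
move=> q1; have s0 := sh_gt0 q1.
have e0 : 0 < q + sh q by rewrite addr_gt0// (lt_trans ltr01 q1).
have h : is_derive q 1 (fun q : R => q + sh q) (1 + q / sh q).
  exact: (der_add (is_derive_id q 1) (der_sh q1)).
apply: (is_derive_eq (der_chain h (is_derive1_ln e0))).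
by field; rewrite !gt_eqF.
Qed.

Lemma arc_gt0 q : 1 < q -> 0 < arc q.
Proof.
by move=> q1; rewrite ln_gt0// (lt_trans q1)// ltrDl sh_gt0.
Qed.

Lemma arc_mono (p q : R) : 1 < p -> p <= q -> arc p <= arc q.
Proof.
move=> p1 pq; have q1 := lt_le_trans p1 pq.
have p0 : 0 < p := lt_trans ltr01 p1; have q0 : 0 < q := lt_trans ltr01 q1.
have s0 := sh_gt0 p1; have s1 := sh_gt0 q1.
rewrite /arc (@ler_ln R) ?posrE ?addr_gt0//.
by rewrite lerD// ler_wsqrtr// lerB// ler_sqr// nnegrE ltW.
Qed.

(* The function ln y - (y^2-1)/(y^2+1) is nondecreasing; here y = q + sh q. *)
Lemma ln_ge_tanh (y : R) : 1 <= y -> (y ^+ 2 - 1) / (y ^+ 2 + 1) <= ln y.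
Proof.
move=> y1; rewrite -subr_ge0.
pose F (y : R) := ln y - (y ^+ 2 - 1) / (y ^+ 2 + 1).
have dF (z : R) : 1 <= z -> is_derive z 1 F (z^-1 - 4 * z / (z ^+ 2 + 1) ^+ 2).
  move=> z1; have z0 : 0 < z := lt_le_trans ltr01 z1.
  have h1 : is_derive z 1 (fun z : R => z ^+ 2 + 1) (2 * z * 1 + 0).
    exact: (der_add (der_sqr (is_derive_id z 1)) (der_cst 1 z 1)).
  have h2 : is_derive z 1 (fun z : R => z ^+ 2 - 1) (2 * z * 1 + 0).
    exact: (der_add (der_sqr (is_derive_id z 1)) (der_cst (-1) z 1)).
  have n0 : z ^+ 2 + 1 != 0 by rewrite gt_eqF// addr_gt0// exprn_gt0.
  apply: (is_derive_eq (der_add (is_derive1_ln z0)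
    (der_opp (der_mul h2 (der_inv h1 n0))))).
  by field; rewrite n0 gt_eqF.
have F1 : F 1 = 0 by rewrite /F ln1 expr1n subrr mul0r subrr.
have [<-|ne] := eqVneq 1 y; first by rewrite -/(F 1) F1.
have y1' : 1 < y by rewrite lt_neqAle ne.
have cF : {within `[1, y], continuous F}.
  apply: derivable_within_continuous => z; rewrite in_itv/= => /andP[z1 _].
  by case: (dF z z1).
have dF' (z : R) : z \in `]1, y[ ->
    is_derive z 1 F (z^-1 - 4 * z / (z ^+ 2 + 1) ^+ 2).
  by rewrite in_itv/= => /andP[/ltW z1 _]; exact: dF.
have [z zI ez] := MVT y1' dF' cF.
move: zI; rewrite in_itv/= => /andP[z1 _].
rewrite -/(F y) -[F y]subr0 -[X in _ - X]F1 ez mulr_ge0 ?subr_ge0 ?(ltW y1')//.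
have z0 : 0 < z := lt_trans ltr01 z1.
rewrite ler_pdivrMr ?exprn_gt0 ?addr_gt0 ?exprn_gt0//.
rewrite [leRHS]mulrC ler_pdivlMr// -subr_ge0.
have -> : (z ^+ 2 + 1) ^+ 2 - 4 * z * z = (z ^+ 2 - 1) ^+ 2 by ring.
exact: sqr_ge0.
Qed.

(** This is tanh r <= r: with y = q + sh q = e^r, the left side of [ln_ge_tanh] is tanh r. Later it
    is used as 1/r <= coth r. *)
Lemma sh_le_arc q : 1 < q -> sh q / q <= arc q.
Proof.
move=> q1; have s0 := sh_gt0 q1; have q0 : 0 < q := lt_trans ltr01 q1.
have y1 : 1 <= q + sh q by rewrite ltW// (lt_trans q1)// ltrDl.
apply: le_trans (ln_ge_tanh y1); have s2 := sh_sqr q1.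
have -> : (q + sh q) ^+ 2 - 1 = 2 * sh q * (q + sh q).
  by lra.
have -> : (q + sh q) ^+ 2 + 1 = 2 * q * (q + sh q) by lra.
by rewrite le_eqVlt; apply/orP; left; apply/eqP; field; rewrite !gt_eqF// addr_gt0.
Qed.

Lemma sh_lt q : 1 < q -> sh q <= q.
Proof.
move=> q1; rewrite -ler_sqr ?nnegrE ?(ltW (sh_gt0 q1)) ?(ltW (lt_trans ltr01 q1))//.
by rewrite sh_sqr// lerBlDr lerDl.
Qed.

End arccosh.

(** * The regularised hyperbolic cosine of the distance to the pole *)

Section radial.
Context {R : realType} {N : nat}.
Variables (a : 'rV[R]_N) (kap : R).
Hypotheses (ha : hyp_space a) (kap1 : 1 < kap).
Implicit Types u : 'rV[R]_N -> R.

Notation e_ i := (delta_mx 0 i : 'rV[R]_N).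
Notation hyp := (@hyp_space R N).
Notation N' := (N%:R : R).
Notation tf := (test_function hyp).

Let B : R := 1 - euclid_sqnorm a.
Let B0 : 0 < B. Proof. by rewrite subr_gt0. Qed.

(** kap cosh d(x, a), by the classical formula cosh d = 1 + 2 |x-a|^2 / ((1-|x|^2)(1-|a|^2)) in the
    ball, in which 1 - |x|^2 = 2 eta. *)
Definition rad (x : 'rV[R]_N) : R :=
  kap * (1 + euclid_sqnorm (x - a) * (eta x)^-1 / (1 - euclid_sqnorm a)).

Definition drad j (x : 'rV[R]_N) : R :=
  kap / (1 - euclid_sqnorm a) *
    (2 * (x 0 j - a 0 j) * (eta x)^-1 +
     euclid_sqnorm (x - a) * (eta x)^-1 ^+ 2 * x 0 j).

Definition d2rad j (x : 'rV[R]_N) : R :=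
  kap / (1 - euclid_sqnorm a) *
    (2 * (eta x)^-1 + 4 * (x 0 j - a 0 j) * x 0 j * (eta x)^-1 ^+ 2 +
     euclid_sqnorm (x - a) * (eta x)^-1 ^+ 2 +
     2 * euclid_sqnorm (x - a) * x 0 j ^+ 2 * (eta x)^-1 ^+ 3).

Lemma sqnormB_ge0 x : 0 <= euclid_sqnorm (x - a).
Proof. by apply: sumr_ge0 => i _; exact: sqr_ge0. Qed.

Lemma rad_ge x : hyp x -> kap <= rad x.
Proof.
move=> /eta_gt0 h; rewrite ler_peMr ?(ltW (lt_trans ltr01 kap1))// lerDl.
by rewrite !mulr_ge0 ?invr_ge0 ?sqnormB_ge0 ?(ltW h) ?(ltW B0).
Qed.

Lemma rad_gt1 x : hyp x -> 1 < rad x.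
Proof. by move=> /rad_ge; exact: lt_le_trans. Qed.

Lemma der_sqnormB x j :
  is_derive x (e_ j) (fun x => euclid_sqnorm (x - a)) (2 * (x 0 j - a 0 j)).
Proof.
rewrite (_ : (fun x => _) = fun x : 'rV[R]_N => \sum_i (x 0 i + - a 0 i) ^+ 2); last first.
  by apply/funext => y; apply: eq_bigr => i _; rewrite !mxE.
have h i := der_sqr (der_add (is_derive_coord x j i) (der_cst (- a 0 i) x (e_ j))).
apply: (is_derive_eq (der_sum _ h)).
rewrite (bigD1 j)//= eqxx addr0 mulr1 big1 ?addr0// => i /negbTE ->.
by rewrite addr0 mulr0.
Qed.

Lemma der_rad x j : hyp x -> is_derive x (e_ j) rad (drad j x).
Proof.
move=> hx.
have h := der_scale kap (der_add (der_cst 1 x (e_ j)) (der_mul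
  (der_mul (der_sqnormB x j) (der_etaV j hx)) (der_cst (1 - euclid_sqnorm a)^-1 x (e_ j)))).
apply: (is_derive_eq h); rewrite /drad.
have h0 : eta x != 0 by rewrite gt_eqF// eta_gt0.
by field; rewrite h0 gt_eqF.
Qed.

Lemma der_drad x j : hyp x -> is_derive x (e_ j) (drad j) (d2rad j x).
Proof.
move=> hx.
have h1 := der_add (is_derive_coord x j j) (der_cst (- a 0 j) x (e_ j)).
have h2 := der_mul (der_mul (der_cst 2 x (e_ j)) h1) (der_etaV j hx).
have h3 := der_mul (der_mul (der_sqnormB x j) (der_sqr (der_etaV j hx)))
  (is_derive_coord x j j).
have h := der_scale (kap / (1 - euclid_sqnorm a)) (der_add h2 h3).
apply: (is_derive_eq h); rewrite /d2rad eqxx mulr1n.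
have h0 : eta x != 0 by rewrite gt_eqF// eta_gt0.
by field; rewrite h0 gt_eqF.
Qed.

Lemma contB_sqnormB : contB (fun x => euclid_sqnorm (x - a)).
Proof.
apply: contB_sum => i; apply: contB_exp.
rewrite (_ : (fun x => _) = fun x : 'rV[R]_N => x 0 i + - a 0 i).
  by apply: contB_add; [exact: contB_coord|exact: contB_cst].
by apply/funext => y; rewrite !mxE.
Qed.

Lemma contB_rad : contB rad.
Proof.
apply: contB_mul; first exact: contB_cst.
apply: contB_add; first exact: contB_cst.
apply: contB_mul; last exact: contB_cst.
by apply: contB_mul; [exact: contB_sqnormB|exact: contB_etaV].
Qed.

Let contB_xa j : contB (fun x : 'rV[R]_N => x 0 j - a 0 j).
Proof. by apply: contB_add; [exact: contB_coord|exact: contB_cst]. Qed.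

Lemma contB_drad j : contB (drad j).
Proof.
have ce := @contB_etaV R N; have cs := contB_sqnormB.
apply: contB_mul; first exact: contB_cst.
apply: contB_add; apply: contB_mul => //; last exact: contB_coord.
  by apply: contB_mul => //; exact: contB_cst.
by apply: contB_mul => //; exact: contB_exp.
Qed.

Lemma contB_d2rad j : contB (d2rad j).
Proof.
have ce := @contB_etaV R N; have cs := contB_sqnormB.
have cx := @contB_coord R N j.
have cc (c : R) := @contB_cst R N c.
apply: contB_mul => //; repeat apply: contB_add; repeat apply: contB_mul => //;
  exact: contB_exp.
Qed.

Let sqnormBE (x : 'rV[R]_N) : euclid_sqnorm (x - a) =
  euclid_sqnorm x - 2 * (\sum_i x 0 i * a 0 i) + euclid_sqnorm a.
Proof.
rewrite /euclid_sqnorm mulr_sumr -sumrN -!big_split /=.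
by apply: eq_bigr => i _; rewrite !mxE; ring.
Qed.

Let sqnorm_eta (x : 'rV[R]_N) : euclid_sqnorm x = 1 - 2 * eta x.
Proof. by rewrite /eta; field. Qed.

Lemma inner_drad x : hyp x -> inner drad drad x = rad x ^+ 2 - kap ^+ 2.
Proof.
move=> hx; rewrite /inner.
have h0 : eta x != 0 by rewrite gt_eqF// eta_gt0.
have [S eS] : {S | euclid_sqnorm (x - a) = S} by exists (euclid_sqnorm (x - a)).
have -> : \sum_j drad j x * drad j x = (kap / B) ^+ 2 *
  (4 * (eta x) ^- 2 * (\sum_i (x - a) 0 i ^+ 2) + 4 * S * (eta x) ^- 3 *
     (\sum_i x 0 i ^+ 2 - \sum_i x 0 i * a 0 i) +
     S ^+ 2 * (eta x) ^- 4 * (\sum_i x 0 i ^+ 2)).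
  rewrite -sumrB !mulr_sumr -!big_split /= mulr_sumr.
  apply: eq_bigr => j _; rewrite /drad eS -/B !mxE.
  by field; rewrite h0 gt_eqF.
rewrite -![\sum_i _ ^+ 2]/(euclid_sqnorm _) eS.
(* Polarisation eliminates the scalar product of x and a; what remains is a rational identity in
   eta, B and the opaque S = |x-a|^2. *)
have e := sqnormBE x; rewrite eS in e.
have -> : \sum_i x 0 i * a 0 i = (euclid_sqnorm x + euclid_sqnorm a - S) / 2.
  by rewrite e; field.
have -> : euclid_sqnorm a = 1 - B by rewrite /B; ring.
rewrite /rad eS -/B sqnorm_eta.
by field; rewrite h0 gt_eqF.
Qed.

Lemma lapl_rad x : hyp x -> lapl_of drad d2rad x = N' * rad x.
Proof.
move=> hx; rewrite /lapl_of.
have h0 : eta x != 0 by rewrite gt_eqF// eta_gt0.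
have [S eS] : {S | euclid_sqnorm (x - a) = S} by exists (euclid_sqnorm (x - a)).
have -> : \sum_j d2rad j x = kap / B *
  (N' * (2 * (eta x)^-1 + S * (eta x) ^- 2) + 4 * (eta x) ^- 2 *
     (\sum_i x 0 i ^+ 2 - \sum_i x 0 i * a 0 i) +
     2 * S * (eta x) ^- 3 * (\sum_i x 0 i ^+ 2)).
  have -> : N' * (2 * (eta x)^-1 + S * (eta x) ^- 2) =
     \sum_(j < N) (2 * (eta x)^-1 + S * (eta x) ^- 2).
    by rewrite sumr_const card_ord mulr_natl.
  rewrite -sumrB !mulr_sumr -!big_split /= mulr_sumr.
  apply: eq_bigr => j _; rewrite /d2rad eS -/B.
  by field; rewrite h0 gt_eqF.
have -> : \sum_j x 0 j * drad j x = kap / B *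
  (2 * (eta x)^-1 * (\sum_i x 0 i ^+ 2 - \sum_i x 0 i * a 0 i) +
     S * (eta x) ^- 2 * (\sum_i x 0 i ^+ 2)).
  rewrite -sumrB !mulr_sumr -!big_split /= mulr_sumr.
  apply: eq_bigr => j _; rewrite /drad eS -/B.
  by field; rewrite h0 gt_eqF.
rewrite -![\sum_i _ ^+ 2]/(euclid_sqnorm _).
have e := sqnormBE x; rewrite eS in e.
have -> : \sum_i x 0 i * a 0 i = (euclid_sqnorm x + euclid_sqnorm a - S) / 2.
  by rewrite e; field.
have -> : euclid_sqnorm a = 1 - B by rewrite /B; ring.
rewrite /rad eS -/B sqnorm_eta.
by field; rewrite h0 gt_eqF.
Qed.

End radial.

(** * The radial Hardy inequality *)

Section radial_inequality.
Context {R : realType} {N : nat}.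
Variables (a : 'rV[R]_N) (kap : R).
Hypotheses (ha : hyp_space a) (kap1 : 1 < kap).
Implicit Types u : 'rV[R]_N -> R.

Notation e_ i := (delta_mx 0 i : 'rV[R]_N).
Notation hyp := (@hyp_space R N).
Notation N' := (N%:R : R).
Notation tf := (test_function hyp).
Notation rad := (rad a kap).
Notation drad := (drad a kap).
Notation d2rad := (d2rad a kap).

Definition rdist (x : 'rV[R]_N) : R := arc (rad x).

Lemma rdist_gt0 x : hyp x -> 0 < rdist x.
Proof. by move=> hx; apply: arc_gt0; exact: rad_gt1. Qed.

Lemma sh_rad_gt0 x : hyp x -> 0 < sh (rad x).
Proof. by move=> hx; apply: sh_gt0; exact: rad_gt1. Qed.

Lemma der_continuous (F : R -> R) (x dF : R) :
  is_derive x 1 F dF -> {for x, continuous F}.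
Proof.
by case=> dFx _; apply: differentiable_continuous; exact/derivable1_diffP.
Qed.

Lemma contB_sh : contB (fun x => sh (rad x)).
Proof.
apply: contB_comp => [|x hx]; first exact: contB_rad.
by apply: (der_continuous (der_sh _)); exact: rad_gt1.
Qed.

Lemma contB_rdist : contB rdist.
Proof.
apply: contB_comp => [|x hx]; first exact: contB_rad.
by apply: (der_continuous (der_arc _)); exact: rad_gt1.
Qed.

Lemma innerDl (p q d : 'I_N -> 'rV[R]_N -> R) x :
  inner (fun j y => p j y + q j y) d x = inner p d x + inner q d x.
Proof.
rewrite /inner -mulrDr -big_split /=; congr (_ * _).
by apply: eq_bigr => j _; rewrite mulrDl.
Qed.

Lemma innerZl (c : 'rV[R]_N -> R) (p d : 'I_N -> 'rV[R]_N -> R) x :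
  inner (fun j y => c y * p j y) d x = c x * inner p d x.
Proof.
rewrite /inner mulrCA; congr (_ * _); rewrite mulr_sumr.
by apply: eq_bigr => j _; rewrite mulrA.
Qed.

Lemma innerC (p q : 'I_N -> 'rV[R]_N -> R) x : inner p q x = inner q p x.
Proof. by rewrite /inner; congr (_ * _); apply: eq_bigr => j _; rewrite mulrC. Qed.

Lemma inner_ge0 (p : 'I_N -> 'rV[R]_N -> R) x : 0 <= inner p p x.
Proof.
by rewrite mulr_ge0 ?sqr_ge0// sumr_ge0// => j _; rewrite -expr2 sqr_ge0.
Qed.

Lemma inner_sqrD (c : R) (p q : 'I_N -> 'rV[R]_N -> R) x :
  inner (fun j y => p j y + c * q j y) (fun j y => p j y + c * q j y) x =
  inner p p x + 2 * c * inner q p x + c ^+ 2 * inner q q x.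
Proof.
rewrite /inner.
have -> : \sum_j (p j x + c * q j x) * (p j x + c * q j x) =
    (\sum_j p j x * p j x) + 2 * c * (\sum_j q j x * p j x) +
    c ^+ 2 * (\sum_j q j x * q j x).
  by rewrite !mulr_sumr -!big_split /=; apply: eq_bigr => j _; ring.
by ring.
Qed.

Variables w dw g dg : R -> R.
Hypothesis w_gt0 : forall r, 0 < r -> 0 < w r.
Hypothesis der_w : forall r : R, 0 < r -> is_derive r 1 w (dw r).
Hypothesis der_g : forall r : R, 0 < r -> is_derive r 1 g (dg r).
Hypothesis cont_dw : forall r : R, 0 < r -> {for r, continuous dw}.
Hypothesis cont_dg : forall r : R, 0 < r -> {for r, continuous dg}.

Let n : R := N' - 1.
(** Chosen so that b(q) grad q = (n/2 coth(r) w - g) grad r. Here n/2 coth r is minus the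
    logarithmic derivative of sinh^(-n/2), the factor that removes the first-order term of the
    radial Laplacian; [g] is a correction left free for each weight. *)
Let b (q : R) : R := (n / 2 * (q / sh q) * w (arc q) - g (arc q)) / sh q.
Let db (q : R) : R :=
  n / 2 * ((sh q) ^- 2 - 2 * q ^+ 2 * (sh q) ^- 4) * w (arc q) +
  n / 2 * q * (sh q) ^- 3 * dw (arc q) - (sh q) ^- 2 * dg (arc q)
  + q * (sh q) ^- 3 * g (arc q).

Let der_b (q : R) : 1 < q -> is_derive q 1 b (db q).
Proof.
move=> q1; have s0 : sh q != 0 by rewrite gt_eqF// sh_gt0.
have r0 := arc_gt0 q1.
have hq := der_mul (is_derive_id q 1) (der_inv (der_sh q1) s0).
have hw := der_chain (der_arc q1) (der_w r0).
have hg := der_chain (der_arc q1) (der_g r0).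
have h := der_mul (der_add (der_mul (der_scale (n / 2) hq) hw) (der_opp hg))
  (der_inv (der_sh q1) s0).
by apply: (is_derive_eq h); rewrite /db; field.
Qed.

Let contB_w : contB (fun x => w (rdist x)).
Proof.
apply: contB_comp => [|x hx]; first exact: contB_rdist.
exact: (der_continuous (der_w (rdist_gt0 hx))).
Qed.

Let contB_g : contB (fun x => g (rdist x)).
Proof.
apply: contB_comp => [|x hx]; first exact: contB_rdist.
exact: (der_continuous (der_g (rdist_gt0 hx))).
Qed.

Let contB_dw : contB (fun x => dw (rdist x)).
Proof.
apply: contB_comp => [|x hx]; first exact: contB_rdist.
exact: (cont_dw (rdist_gt0 hx)).
Qed.

Let contB_dg : contB (fun x => dg (rdist x)).
Proof.
apply: contB_comp => [|x hx]; first exact: contB_rdist.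
exact: (cont_dg (rdist_gt0 hx)).
Qed.

Let contB_shV : contB (fun x => (sh (rad x))^-1).
Proof.
apply: contB_inv => [|x hx]; first exact: contB_sh.
by rewrite gt_eqF// sh_rad_gt0.
Qed.

Let contB_b : contB (fun x => b (rad x)).
Proof.
have cs := contB_shV; have cr := @contB_rad R N a kap.
apply: contB_mul => //; apply: contB_add; last exact: contB_opp.
apply: contB_mul => //; apply: contB_mul; first exact: contB_cst.
exact: contB_mul.
Qed.

Let contB_db : contB (fun x => db (rad x)).
Proof.
have cr := @contB_rad R N a kap.
have cs k : contB (fun x => (sh (rad x)) ^- k).
  have -> : (fun x => (sh (rad x)) ^- k) = fun x => (sh (rad x))^-1 ^+ k.
    by apply/funext => x; rewrite exprVn.
  exact: contB_exp contB_shV.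
have cc (c : R) := @contB_cst R N c.
apply: contB_add; last by apply: contB_mul => //; exact: contB_mul.
apply: contB_add; last by apply: contB_opp; exact: contB_mul.
apply: contB_add; last first.
  by apply: contB_mul => //; apply: contB_mul => //; exact: contB_mul.
apply: contB_mul => //; apply: contB_mul => //; apply: contB_add => //.
apply: contB_opp; apply: contB_mul => //; apply: contB_mul => //.
exact: contB_exp.
Qed.

(* With tau = |grad rdist|^2 in [0, 1], the potential produced by completing
   the square is the convex combination of the two right-hand sides below. *)
Lemma radial_ineq (M : 'rV[R]_N -> R) u : tf u -> contB M ->
  (forall x, hyp x -> let r := rdist x in let c := rad x / sh (rad x) in
    M x <= w r * (n * (n - 2) / 4 * c ^+ 2 + n / 2) - dg r
           - (g r - dw r / 2) ^+ 2 / w r) ->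
  (forall x, hyp x -> let r := rdist x in let c := rad x / sh (rad x) in
    M x <= N' * c * (n / 2 * c * w r - g r)) ->
  hint (fun x => u x ^+ 2 * M x) <=
  hint (fun x => - (w (rdist x) * u x * lapl u x)).
Proof.
move=> tu cM hM1 hM2.
have nu := tf_nice tu; have npu j := tf_partial_nice j tu.
have cpu j : contB (partial j u) by case: (npu j).
have nW : nice (fun x => w (rdist x) * u x) by exact: niceMl.
have nlu := tf_nice (tf_lapl tu).
have cdW : contB (fun x => dw (rdist x) / sh (rad x)) by exact: contB_mul.
pose dp1 j (x : 'rV[R]_N) := w (rdist x) * partial j u x +
  u x * (dw (rdist x) / sh (rad x) * drad j x).
have ndp1 j : nice (dp1 j).
  apply: niceD; first exact: niceMl.
  by apply: niceMr => //; apply: contB_mul => //; exact: contB_drad.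
pose dp2 j (x : 'rV[R]_N) := u x ^+ 2 * (db (rad x) * drad j x) +
  b (rad x) * (2 * u x * partial j u x).
have ndp2 j : nice (dp2 j).
  apply: niceD; first by apply: niceMr; [exact: nice_sqr|
    apply: contB_mul => //; exact: contB_drad].
  by apply: niceMl => //; apply: niceMr => //; exact: niceZ.
(* The field w u grad u: it turns the integral of - w u Delta u into that of w |grad u|^2 + u w'
   grad r . grad u. *)
have G1 : hint (fun x => w (rdist x) * u x * lapl u x +
    inner dp1 (fun j => partial j u) x) = 0.
  apply: (@green _ _ (fun x => w (rdist x) * u x) dp1).
  - move=> x j hx; have q1 := rad_gt1 ha kap1 hx.
    have := der_mul (der_chain (der_rad kap ha j hx)
      (der_chain (der_arc q1) (der_w (arc_gt0 q1)))) (tf_der x j tu).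
    exact.
  - by case: nW.
  - by move=> j; case: (ndp1 j).
  - by case: nW.
  - by move=> j; case: (ndp1 j).
  - by move=> x j _; exact: tf_der2.
  - by [].
  - by move=> j; exact: tf_partial2_cont.
(* The field u^2 b(q) grad q, whose divergence integrates to 0 and may be added at will. *)
have G2 : hint (fun x => u x ^+ 2 * b (rad x) * lapl_of drad d2rad x +
    inner dp2 drad x) = 0.
  have n2 : nice (fun x => u x ^+ 2 * b (rad x)).
    by apply: niceMr => //; exact: nice_sqr.
  apply: (@green _ _ (fun x => u x ^+ 2 * b (rad x)) dp2).
  - move=> x j hx; have q1 := rad_gt1 ha kap1 hx.
    have := der_mul (der_sqr (tf_der x j tu))
       (der_chain (der_rad kap ha j hx) (der_b q1)).
    exact.
  - by case: n2.
  - by move=> j; case: (ndp2 j).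
  - by case: n2.
  - by move=> j; case: (ndp2 j).
  - by move=> x j; exact: der_drad.
  - by move=> j; exact: contB_drad.
  - by move=> j; exact: contB_d2rad.
have nF : nice (fun x => - (w (rdist x) * u x * lapl u x)).
  have -> : (fun x => - (w (rdist x) * u x * lapl u x)) =
    fun x => -1 * (w (rdist x) * u x * lapl u x).
    by apply/funext => x; rewrite mulN1r.
  by apply: niceZ; apply: niceMr => //; case: nlu.
have nG1 : nice (fun x => w (rdist x) * u x * lapl u x +
    inner dp1 (fun j => partial j u) x).
  apply: niceD; first by apply: niceMr => //; case: nlu.
  exact: nice_inner.
have clr : contB (lapl_of drad d2rad).
  have ce := @contB_eta R N.
  apply: contB_add; apply: contB_mul.
  - exact: contB_exp.
  - by apply: contB_sum => j; exact: contB_d2rad.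
  - by apply: contB_mul => //; exact: contB_cst.
  - apply: contB_sum => j; apply: contB_mul; first exact: contB_coord.
    exact: contB_drad.
have nG2 : nice (fun x => u x ^+ 2 * b (rad x) * lapl_of drad d2rad x +
    inner dp2 drad x).
  apply: niceD; last by apply: nice_inner => // j; exact: contB_drad.
  by apply: niceMr => //; apply: niceMr => //; exact: nice_sqr.
rewrite -[leRHS]addr0 -G1 -hintD// -[leRHS]addr0 -G2 -hintD//; last exact: niceD.
apply: le_hint; first by apply: niceMr => //; exact: nice_sqr.
  by apply: niceD => //; exact: niceD.
move=> x hx.
have {hM1} := hM1 x hx; have {hM2} := hM2 x hx.
rewrite lapl_rad// !innerDl /dp1 /dp2 /=.
have q1 := rad_gt1 ha kap1 hx.
have -> : inner (fun j x => u x * (dw (rdist x) / sh (rad x) * drad j x))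
    (fun j => partial j u) x =
    u x * (dw (rdist x) / sh (rad x)) * inner drad (fun j => partial j u) x.
  rewrite innerZl -mulrA; congr (_ * _).
  exact: (innerZl (fun x => dw (rdist x) / sh (rad x))).
have -> : inner (fun j x => w (rdist x) * partial j u x) (fun j => partial j u) x =
    w (rdist x) * inner (fun j => partial j u) (fun j => partial j u) x.
  exact: (innerZl (fun x => w (rdist x))).
have -> : inner (fun j x => u x ^+ 2 * (db (rad x) * drad j x)) drad x =
    u x ^+ 2 * (db (rad x) * inner drad drad x).
  rewrite (innerZl (fun x => u x ^+ 2)); congr (_ * _).
  exact: (innerZl (fun x => db (rad x))).
have -> : inner (fun j x => b (rad x) * (2 * u x * partial j u x)) drad x =
    b (rad x) * (2 * u x * inner drad (fun j => partial j u) x).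
  rewrite (innerZl (fun x => b (rad x))); congr (_ * _).
  by rewrite (innerZl (fun x => 2 * u x)) innerC.
set G := inner _ _ x; set E := inner drad _ x.
have W0 := w_gt0 (rdist_gt0 hx).
(* The coefficient of u grad q . grad u after adding both identities. The square completed below is
   w |grad u + (u A / (2 w)) grad q|^2. *)
pose A := dw (rdist x) / sh (rad x) + 2 * b (rad x).
have sq : 0 <= w (rdist x) * G + u x * A * E +
    u x ^+ 2 * A ^+ 2 / (4 * w (rdist x)) * inner drad drad x.
  have := inner_ge0 (fun j y => partial j u y +
    (u x * A / (2 * w (rdist x))) * drad j y) x.
  rewrite inner_sqrD -/G -/E => /(mulr_ge0 (ltW W0)); congr (_ <= _).
  by field; rewrite gt_eqF.
move=> h2 h1.
have K0 := inner_ge0 drad x; rewrite inner_drad// in sq K0 *.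
have s0 := sh_rad_gt0 hx; have s2 := sh_sqr q1.
pose tau := (rad x ^+ 2 - kap ^+ 2) / sh (rad x) ^+ 2.
have tau0 : 0 <= tau by rewrite divr_ge0// exprn_ge0// ltW.
have tau1 : tau <= 1.
  rewrite ler_pdivrMr ?exprn_gt0// mul1r s2 lerB// exprn_ege1 ?ltW//.
(* The remaining potential is affine in tau, so weights 1 - tau and tau on the two hypotheses bound
   it from below. *)
have h : M x <= b (rad x) * (N' * rad x) + db (rad x) * (rad x ^+ 2 - kap ^+ 2)
    - A ^+ 2 / (4 * w (rdist x)) * (rad x ^+ 2 - kap ^+ 2).
  have eK : rad x ^+ 2 - kap ^+ 2 = tau * sh (rad x) ^+ 2.
    by rewrite /tau; field; rewrite gt_eqF.
  rewrite eK -[M x]mul1r -[X in X * M x](subrK tau) mulrDl.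
  have := lerD (ler_wpM2l (_ : 0 <= 1 - tau) h2) (ler_wpM2l tau0 h1).
  rewrite subr_ge0 => /(_ tau1) /le_trans; apply.
  rewrite le_eqVlt; apply/orP; left; apply/eqP.
  rewrite /A /b /db -/(rdist x) /n.
  by field; rewrite !gt_eqF.
apply: le_trans (ler_wpM2l (sqr_ge0 (u x)) h) _.
rewrite -subr_ge0; apply: le_trans sq _.
rewrite le_eqVlt; apply/orP; left; apply/eqP; rewrite /A.
by field; rewrite !gt_eqF.
Qed.

End radial_inequality.

(** * Hardy inequalities *)

Section weights.
Context {R : realType} {N : nat}.
Variables (a : 'rV[R]_N) (kap : R).
Hypotheses (ha : hyp_space a) (kap1 : 1 < kap).
Implicit Types u v : 'rV[R]_N -> R.

Notation hyp := (@hyp_space R N).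
Notation N' := (N%:R : R).
Notation tf := (test_function hyp).
Notation rad := (rad a kap).
Notation rdist := (rdist a kap).
Notation n := (N' - 1).

Definition invd (x : 'rV[R]_N) : R := (rdist x)^-1.
Definition coth (x : 'rV[R]_N) : R := rad x / sh (rad x).
Definition csch2 (x : 'rV[R]_N) : R := (sh (rad x)) ^- 2.

Lemma invd_gt0 x : hyp x -> 0 < invd x.
Proof. by move=> hx; rewrite invr_gt0 rdist_gt0. Qed.

Lemma coth_ge1 x : hyp x -> 1 <= coth x.
Proof.
move=> hx; have q1 := rad_gt1 ha kap1 hx.
by rewrite ler_pdivlMr ?sh_gt0// mul1r sh_lt.
Qed.

Lemma invd_le_coth x : hyp x -> invd x <= coth x.
Proof.
move=> hx; have q1 := rad_gt1 ha kap1 hx.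
have q0 : 0 < rad x := lt_trans ltr01 q1.
rewrite /invd /coth -[leRHS]invf_div lef_pV2 ?posrE ?rdist_gt0 ?divr_gt0 ?sh_gt0//.
exact: sh_le_arc.
Qed.

Lemma csch2_gt0 x : hyp x -> 0 < csch2 x.
Proof. by move=> hx; rewrite invr_gt0 exprn_gt0// (sh_rad_gt0 ha kap1). Qed.

Lemma coth_sqr x : hyp x -> coth x ^+ 2 = 1 + csch2 x.
Proof.
move=> hx; have q1 := rad_gt1 ha kap1 hx.
rewrite /coth /csch2 expr_div_n; have e := sh_sqr q1.
have -> : rad x ^+ 2 = sh (rad x) ^+ 2 + 1 by rewrite e subrK.
by field; rewrite gt_eqF// sh_gt0.
Qed.

Lemma contB_invd : contB invd.
Proof.
apply: contB_inv => [|x hx]; first exact: contB_rdist.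
by rewrite gt_eqF// rdist_gt0.
Qed.

Lemma contB_csch2 : contB csch2.
Proof.
have -> : csch2 = fun x => (sh (rad x))^-1 ^+ 2.
  by apply/funext => x; rewrite exprVn.
apply: contB_exp; apply: contB_inv => [|x hx]; first exact: contB_sh.
by rewrite gt_eqF// (sh_rad_gt0 ha kap1).
Qed.

Lemma der_powV k (r : R) : 0 < r ->
  is_derive r 1 (fun r : R => r^-1 ^+ k) (- k%:R * r^-1 ^+ k.+1).
Proof.
move=> r0; have r0' : r != 0 by rewrite gt_eqF.
have h := der_exp k (der_inv (is_derive_id r 1) r0').
apply: (is_derive_eq h); case: k {h} => [|k] /=; first by rewrite !mul0r oppr0 mul0r.
by rewrite -[k.+1%:R]natr1 !exprS; field.
Qed.

Lemma cont_scale_powV (c : R) k (r : R) : 0 < r ->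
  {for r, continuous (fun r : R => c * r^-1 ^+ k)}.
Proof. by move=> r0; exact: (der_continuous (der_scale c (der_powV k r0))). Qed.

(** Takes w = r^-k and g = r^(-k-1) / 2. Among g = c r^(-k-1), the gain c (k+1) - (c + k/2)^2 is
    largest at c = 1/2, where it equals (1 - k^2)/4. *)
Lemma power_ineq k (M : 'rV[R]_N -> R) u : tf u -> contB M ->
  (forall x, hyp x -> M x <= invd x ^+ k *
     (n * (n - 2) / 4 * coth x ^+ 2 + n / 2 + (1 - k%:R ^+ 2) / 4 * invd x ^+ 2)) ->
  (forall x, hyp x -> M x <= N' * coth x *
     (n / 2 * coth x * invd x ^+ k - 2^-1 * invd x ^+ k.+1)) ->
  hint (fun x => u x ^+ 2 * M x) <=
  hint (fun x => - (invd x ^+ k * u x * lapl u x)).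
Proof.
move=> tu cM h1 h2.
apply: (@radial_ineq _ _ _ _ ha kap1 (fun r => r^-1 ^+ k)
  (fun r => - k%:R * r^-1 ^+ k.+1) (fun r => 2^-1 * r^-1 ^+ k.+1)
  (fun r => 2^-1 * (- k.+1%:R * r^-1 ^+ k.+2))) => //.
- by move=> r r0; rewrite exprn_gt0// invr_gt0.
- by move=> r; exact: der_powV.
- by move=> r r0; apply: der_scale; exact: der_powV.
- by move=> r; exact: cont_scale_powV.
- move=> r r0.
  have -> : (fun r : R => 2^-1 * (- k.+1%:R * r^-1 ^+ k.+2)) =
    fun r => (2^-1 * - k.+1%:R) * r^-1 ^+ k.+2.
    by apply/funext => z; rewrite mulrA.
  exact: cont_scale_powV.
move=> x hx /=; apply: le_trans (h1 x hx) _.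
rewrite le_eqVlt; apply/orP; left; apply/eqP.
rewrite -/(coth x) -/(invd x) -[k.+1%:R]natr1.
have y0 := invd_gt0 hx; rewrite !exprS.
have p0 : invd x ^+ k != 0 by rewrite gt_eqF// exprn_gt0.
by field; rewrite p0.
Qed.

Lemma n_ge (m : nat) : (m < N)%N -> m%:R <= n.
Proof. by move=> h; rewrite lerBrDr natr1 ler_nat. Qed.

(** Replacing coth^2 by r^-2 in [power_ineq] gives the coefficient n (n-2)/4 + (1-k^2)/4 of
    r^(-k-2), and n (n-2) + 1 = (N-2)^2. *)
Definition rellich_const (k : nat) : R := ((N' - 2) ^+ 2 - k%:R ^+ 2) / 4.

Lemma hardy_power k u : (2 < N)%N -> (0 < k)%N -> tf u ->
  hint (fun x => u x ^+ 2 *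
     (rellich_const k * invd x ^+ k.+2 + n / 2 * invd x ^+ k)) <=
  hint (fun x => - (invd x ^+ k * u x * lapl u x)).
Proof.
move=> N2 k0 tu; have n2 := n_ge N2.
have n0 : 0 <= n by rewrite (le_trans _ n2).
have n20 : 0 <= n - 2 by rewrite subr_ge0.
have cy := contB_invd.
apply: power_ineq => //.
  by apply: contB_add; apply: contB_mul; [exact: contB_cst|exact: contB_exp..|
     exact: contB_cst|exact: contB_exp].
- move=> x hx; have y0 := invd_gt0 hx; have yc := invd_le_coth hx.
  rewrite [invd x ^+ k.+2]exprS [invd x ^+ k.+1]exprS /rellich_const.
  set P := invd x ^+ k; have P0 : 0 <= P by rewrite exprn_ge0// ltW.
  have yc2 : invd x ^+ 2 <= coth x ^+ 2.
    by rewrite ler_sqr// nnegrE ltW// (lt_le_trans y0).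
  rewrite -subr_ge0.
  have -> : P * (n * (n - 2) / 4 * coth x ^+ 2 + n / 2 +
    (1 - k%:R ^+ 2) / 4 * invd x ^+ 2) -
    (((N' - 2) ^+ 2 - k%:R ^+ 2) / 4 * (invd x * (invd x * P)) + n / 2 * P) =
    P * (n * (n - 2) / 4 * (coth x ^+ 2 - invd x ^+ 2)) by field.
  by rewrite (mulr_ge0 P0)// mulr_ge0 ?(subr_ge0 (invd x ^+ 2))// !mulr_ge0.
(* The bound at tau = 0 has room to spare: 1 and 1/r are both at most coth r, so all terms compare
   with coth^2. *)
- move=> x hx; have y0 := invd_gt0 hx; have yc := invd_le_coth hx.
  have c1 := coth_ge1 hx.
  rewrite [invd x ^+ k.+2]exprS [invd x ^+ k.+1]exprS /rellich_const.
  set P := invd x ^+ k; have P0 : 0 <= P by rewrite exprn_ge0// ltW.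
  set y := invd x in y0 yc *; set c := coth x in yc c1 *.
  have K0 : 0 <= k%:R ^+ 2 * y ^+ 2 by rewrite -exprMn sqr_ge0.
  have -> : ((N' - 2) ^+ 2 - k%:R ^+ 2) / 4 * (y * (y * P)) + n / 2 * P =
    P * ((n - 1) ^+ 2 / 4 * y ^+ 2 - k%:R ^+ 2 * y ^+ 2 / 4 + n / 2) by field.
  have -> : N' * c * (n / 2 * c * P - 2^-1 * (y * P)) =
    P * ((n + 1) * c * (n * c - y) / 2) by field.
  apply: ler_wpM2l => //.
  have yc2 : y ^+ 2 <= c ^+ 2 by rewrite ler_sqr// nnegrE ltW// (lt_le_trans y0).
  have c2 : 1 <= c ^+ 2 by rewrite exprn_ege1.
  have e1 : (n - 1) ^+ 2 * y ^+ 2 <= (n - 1) ^+ 2 * c ^+ 2.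
    by rewrite ler_wpM2l// sqr_ge0.
  have e2 : n * 1 <= n * c ^+ 2 by rewrite ler_wpM2l.
  have e3 : (n + 1) * (c * y) <= (n + 1) * (c * c).
    apply: ler_wpM2l; first by apply: addr_ge0.
    by apply: ler_wpM2l => //; exact: le_trans ler01 c1.
  have e4 : 0 <= (n ^+ 2 - 4) * c ^+ 2.
    by rewrite mulr_ge0 ?sqr_ge0//; move: n2 n0; set m := n; clearbody m; nra.
  have : 0 <= c ^+ 2 by exact: sqr_ge0.
  move: e1 e2 e3 e4 K0; rewrite !expr2.
  set m := n; clearbody m; nra.
Qed.

(** With weight 1 it is coth^2 >= 1 that is used: n (n-2)/4 + n/2 = n^2/4 preserves the spectral
    gap, and g = 1/(2r) contributes the Hardy term. *)
Lemma hardy_zero u : (2 < N)%N -> tf u ->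
  hint (fun x => u x ^+ 2 * (n ^+ 2 / 4 + 4^-1 * invd x ^+ 2)) <=
  hint (fun x => - (u x * lapl u x)).
Proof.
move=> N2 tu; have n2 := n_ge N2.
have n0 : 0 <= n by rewrite (le_trans _ n2).
have n20 : 0 <= n - 2 by rewrite subr_ge0.
have -> : (fun x => - (u x * lapl u x)) =
  (fun x => - (invd x ^+ 0 * u x * lapl u x)).
  by apply/funext => x; rewrite expr0 mul1r.
have cy := contB_invd.
apply: power_ineq => //.
  by apply: contB_add; [|apply: contB_mul; [|exact: contB_exp]]; exact: contB_cst.
- move=> x hx; have c1 := coth_ge1 hx.
  have c2 : 1 <= coth x ^+ 2 by rewrite exprn_ege1.
  have : n * (n - 2) * 1 <= n * (n - 2) * coth x ^+ 2.
    by rewrite ler_wpM2l// mulr_ge0.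
  rewrite expr0 expr0n /=; set m := n; clearbody m; nra.
- move=> x hx; have y0 := invd_gt0 hx; have yc := invd_le_coth hx.
  have c1 := coth_ge1 hx.
  rewrite expr0 expr1.
  set y := invd x in y0 yc *; set c := coth x in yc c1 *.
  have -> : N' * c * (n / 2 * c * 1 - 2^-1 * y) = (n + 1) * c * (n * c - y) / 2.
    by field.
  have yc2 : y ^+ 2 <= c ^+ 2 by rewrite ler_sqr// nnegrE ltW// (lt_le_trans y0).
  have c2 : 1 <= c ^+ 2 by rewrite exprn_ege1.
  have e2 : n ^+ 2 * 1 <= n ^+ 2 * c ^+ 2 by rewrite ler_wpM2l// sqr_ge0.
  have e3 : (n + 1) * (c * y) <= (n + 1) * (c * c).
    apply: ler_wpM2l; first by apply: addr_ge0.
    by apply: ler_wpM2l => //; exact: le_trans ler01 c1.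
  have e4 : 0 <= (n ^+ 2 - 4) * c ^+ 2.
    by rewrite mulr_ge0 ?sqr_ge0//; move: n2 n0; set m := n; clearbody m; nra.
  have : 0 <= c ^+ 2 by exact: sqr_ge0.
  move: e2 e3 e4 yc2; rewrite !expr2.
  set m := n; clearbody m; nra.
Qed.

End weights.

(** * Hyperbolic functions of the regularised distance *)

Section hyperbolic_functions.
Context {R : realType}.
Implicit Types q r : R.

(** [radial_ineq] takes its weights as functions of r, so csch^2 has to be differentiated in r;
    [sinh_arc] and [cosh_arc] translate back to q. *)
Definition sinh r : R := (expR r - expR (- r)) / 2.
Definition cosh r : R := (expR r + expR (- r)) / 2.

Lemma der_expRN (r : R) : is_derive r 1 (fun r : R => expR (- r)) (- expR (- r)).
Proof.
have h := der_chain (der_opp (is_derive_id r 1)) (is_derive_expR (- r)).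
by apply: (is_derive_eq h); rewrite mulrN1.
Qed.

Lemma der_sinh (r : R) : is_derive r 1 sinh (cosh r).
Proof.
have h := der_mul (der_add (is_derive_expR r) (der_opp (der_expRN r)))
  (der_cst 2^-1 r 1).
by apply: (is_derive_eq h); rewrite /cosh; field.
Qed.

Lemma der_cosh (r : R) : is_derive r 1 cosh (sinh r).
Proof.
have h := der_mul (der_add (is_derive_expR r) (der_expRN r)) (der_cst 2^-1 r 1).
by apply: (is_derive_eq h); rewrite /sinh; field.
Qed.

Lemma sinh_gt0 r : 0 < r -> 0 < sinh r.
Proof.
by move=> r0; rewrite divr_gt0// subr_gt0 ltr_expR gtrN.
Qed.

Lemma expR_arc q : 1 < q -> expR (arc q) = q + sh q.
Proof.
by move=> q1; rewrite lnK// posrE addr_gt0 ?sh_gt0// (lt_trans ltr01 q1).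
Qed.

Lemma expRN_arc q : 1 < q -> expR (- arc q) = q - sh q.
Proof.
move=> q1; rewrite expRN expR_arc//.
have s2 := sh_sqr q1.
have h0 : q + sh q != 0 by rewrite gt_eqF// addr_gt0 ?sh_gt0// (lt_trans ltr01 q1).
apply: (mulfI h0); rewrite divff// mulrC -subr_sqr s2; ring.
Qed.

Lemma sinh_arc q : 1 < q -> sinh (arc q) = sh q.
Proof. by move=> q1; rewrite /sinh expR_arc// expRN_arc//; field. Qed.

Lemma cosh_arc q : 1 < q -> cosh (arc q) = q.
Proof. by move=> q1; rewrite /cosh expR_arc// expRN_arc//; field. Qed.

End hyperbolic_functions.

(** * Hardy inequalities for the Poincare-Rellich argument *)

Section rellich.
Context {R : realType} {N : nat}.
Variables (a : 'rV[R]_N) (kap : R).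
Hypotheses (ha : hyp_space a) (kap1 : 1 < kap).
Implicit Types u v : 'rV[R]_N -> R.

Notation hyp := (@hyp_space R N).
Notation N' := (N%:R : R).
Notation tf := (test_function hyp).
Notation rad := (rad a kap).
Notation rdist := (rdist a kap).
Notation invd := (invd a kap).
Notation coth := (coth a kap).
Notation csch2 := (csch2 a kap).
Notation n := (N' - 1).

(** The weight csch^2 r with g = 0: the loss (w'/2)^2 / w equals coth^2 csch^2, which accounts for
    both -1 once coth^2 = 1 + csch^2 is inserted. *)
Lemma hardy_csch2 u : (2 < N)%N -> tf u ->
  hint (fun x => u x ^+ 2 * (csch2 x * (n ^+ 2 / 4 - 1 +
     (n * (n - 2) / 4 - 1) * csch2 x))) <=
  hint (fun x => - (csch2 x * u x * lapl u x)).
Proof.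
move=> N2 tu; have n2 := @n_ge R N _ N2; have ct := contB_csch2 ha kap1.
have nw : nice (fun x => u x * lapl u x).
  apply: niceMr; first exact: tf_nice.
  by case: (tf_nice (tf_lapl tu)).
have q1 x (hx : hyp x) := rad_gt1 ha kap1 hx.
have wE x : hyp x -> (sinh (rdist x))^-1 ^+ 2 = csch2 x.
  by move=> hx; rewrite /csch2 /rdist sinh_arc ?q1// exprVn.
(* The two forms of the weight are known to agree on the ball only, hence the passage through
   [eq_hint]. *)
have -> : hint (fun x => - (csch2 x * u x * lapl u x)) =
  hint (fun x => - ((sinh (rdist x))^-1 ^+ 2 * u x * lapl u x)).
  have e : (fun x => - (csch2 x * u x * lapl u x)) =
    (fun x => (-1 * csch2 x) * (u x * lapl u x)) by apply/funext => x; ring.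
  have cs : contB (fun x => (sinh (rdist x))^-1 ^+ 2).
    apply: contB_exp; apply: contB_inv => [|x hx]; last first.
      by rewrite gt_eqF// sinh_gt0// rdist_gt0.
    apply: contB_comp => [|x hx]; first exact: contB_rdist.
    exact: der_continuous (der_sinh _).
  have e' : (fun x => - ((sinh (rdist x))^-1 ^+ 2 * u x * lapl u x)) =
    (fun x => (-1 * (sinh (rdist x))^-1 ^+ 2) * (u x * lapl u x)).
    by apply/funext => x; ring.
  rewrite e e'; apply: eq_hint => [||x hx]; last by rewrite wE.
    by apply: niceMl => //; apply: contB_mul => //; exact: contB_cst.
  by apply: niceMl => //; apply: contB_mul => //; exact: contB_cst.
apply: (@radial_ineq _ _ _ _ ha kap1 (fun r => (sinh r)^-1 ^+ 2)
  (fun r => -2 * (cosh r * (sinh r)^-1 ^+ 3)) (fun=> 0) (fun=> 0)) => //.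
- by move=> r r0; rewrite exprn_gt0// invr_gt0 sinh_gt0.
- move=> r r0; have s0 : sinh r != 0 by rewrite gt_eqF// sinh_gt0.
  by apply: (is_derive_eq (der_sqr (der_inv (der_sinh r) s0))); field.
- move=> r r0; have s0 : sinh r != 0 by rewrite gt_eqF// sinh_gt0.
  exact: (der_continuous (der_scale (-2) (der_mul (der_cosh r)
    (der_exp 3 (der_inv (der_sinh r) s0))))).
- by move=> r _; exact: cst_continuous.
- have cc (c : R) := @contB_cst R N c.
  by do 2 (apply: contB_mul => //; try apply: contB_add => //).
- move=> x hx /=; have t0 := csch2_gt0 ha kap1 hx.
  have s0 := sh_rad_gt0 ha kap1 hx.
  rewrite wE// sinh_arc ?q1// cosh_arc ?q1// -/(coth x) coth_sqr//.
  rewrite le_eqVlt; apply/orP; left; apply/eqP.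
  have -> : rad x * (sh (rad x))^-1 ^+ 3 = coth x * csch2 x.
    by rewrite /coth /csch2; field; rewrite gt_eqF.
  have -> : (0 - -2 * (coth x * csch2 x) / 2) ^+ 2 = coth x ^+ 2 * csch2 x ^+ 2.
    by field.
  by rewrite coth_sqr//; field; rewrite gt_eqF.
- move=> x hx /=; have t0 := csch2_gt0 ha kap1 hx.
  rewrite wE// -/(coth x) subr0.
  have -> : N' * coth x * (n / 2 * coth x * csch2 x) =
    csch2 x * ((n + 1) * n / 2 * coth x ^+ 2) by field.
  apply: ler_wpM2l; first exact: ltW.
  rewrite coth_sqr//; move: n2 t0; set m := n; set t := csch2 x.
  clearbody m t => m2 t0; nra.
Qed.

Definition lorentz (x : 'rV[R]_N) : R := (1 + rdist x ^+ 2)^-1.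

(* The field 1/(2 r (1 + r^2)) added to the optimal Hardy field 1/(2 r) produces
   the term lorentz^2, which behaves as r^-4 at infinity, where csch2 is too
   small to dominate the r^-4 of the Poincare-Rellich inequality. *)
Lemma hardy_improved u : (4 < N)%N -> tf u ->
  hint (fun x => u x ^+ 2 * (n ^+ 2 / 4 + n * (n - 2) / 4 * csch2 x +
    invd x ^+ 2 / 4 + lorentz x ^+ 2 * (1 - invd x ^+ 2 / 4))) <=
  hint (fun x => - (u x * lapl u x)).
Proof.
move=> N4 tu; have n4 := @n_ge R N _ N4; have ct := contB_csch2 ha kap1.
have cy := contB_invd ha kap1.
have D0 (r : R) : 1 + r ^+ 2 != 0.
  by rewrite gt_eqF// ltr_pwDl// sqr_ge0.
have dD (r : R) : is_derive r 1 (fun r : R => (1 + r ^+ 2)^-1)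
    (- (2 * r) * (1 + r ^+ 2)^-1 ^+ 2).
  have h := der_inv (der_add (der_cst 1 r 1) (der_sqr (is_derive_id r 1))) (D0 r).
  by apply: (is_derive_eq h); rewrite -exprVn; field.
have cl : contB lorentz.
  apply: (contB_comp (G := fun r : R => (1 + r ^+ 2)^-1)) => [|x hx].
    exact: contB_rdist.
  exact: (der_continuous (dD _)).
have -> : (fun x => - (u x * lapl u x)) = (fun x => - (1 * u x * lapl u x)).
  by apply/funext => x; rewrite mul1r.
apply: (@radial_ineq _ _ _ _ ha kap1 (fun=> 1) (fun=> 0)
  (fun r => r^-1 ^+ 1 * (2^-1 + 2^-1 * (1 + r ^+ 2)^-1))
  (fun r => - r^-1 ^+ 2 * (2^-1 + 2^-1 * (1 + r ^+ 2)^-1) -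
      (1 + r ^+ 2)^-1 ^+ 2)) => //.
- move=> r r0; have h := der_mul (der_powV 1 r0)
    (der_add (der_cst 2^-1 r 1) (der_scale 2^-1 (dD r))).
  by apply: (is_derive_eq h); rewrite expr1; field; rewrite D0 gt_eqF.
- by move=> r _; exact: cst_continuous.
- move=> r r0; have h := der_add (der_mul (der_opp (der_powV 2 r0))
    (der_add (der_cst 2^-1 r 1) (der_scale 2^-1 (dD r))))
    (der_opp (der_sqr (dD r))).
  exact: (der_continuous h).
- have cc (c : R) := @contB_cst R N c.
  have cy2 : contB (fun x => invd x ^+ 2) by exact: contB_exp.
  apply: contB_add; first by
    apply: contB_add; [apply: contB_add => //|]; exact: contB_mul.
  apply: contB_mul; first exact: contB_exp.
  by apply: contB_add => //; apply: contB_opp; exact: contB_mul.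
- move=> x hx /=; rewrite -/(coth x) coth_sqr// -/(lorentz x) expr1 -/(invd x).
  rewrite le_eqVlt; apply/orP; left; apply/eqP.
  set t := csch2 x; set l := lorentz x; set y := invd x.
  by field.
- move=> x hx /=; rewrite -/(coth x) -/(lorentz x) expr1 -/(invd x).
  have y0 := invd_gt0 ha kap1 hx; have yc := invd_le_coth ha kap1 hx.
  have c1 := coth_ge1 ha kap1 hx; have r0 := rdist_gt0 ha kap1 hx.
  have c2 := coth_sqr ha kap1 hx; have t0 := csch2_gt0 ha kap1 hx.
  have l0 : 0 <= lorentz x by rewrite invr_ge0 addr_ge0// sqr_ge0.
  have l1 : lorentz x <= 1.
    by rewrite invf_le1 ?ltr_pwDl ?sqr_ge0// lerDl sqr_ge0.
  (* From 2 r <= 1 + r^2. It makes lorentz^2 at most r^-2 / 4, so that the new term stays harmless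
     in the bound at tau = 0. *)
  have ly : 2 * lorentz x <= invd x.
    rewrite /lorentz /invd -[leRHS]mul1r ler_pdivlMr// mulrAC -subr_ge0.
    have -> : 1 - 2 * rdist x / (1 + rdist x ^+ 2) =
      (1 - rdist x) ^+ 2 / (1 + rdist x ^+ 2) by field; rewrite D0.
    by rewrite divr_ge0 ?sqr_ge0// addr_ge0// sqr_ge0.
  move: y0 yc c1 c2 t0 l0 l1 ly n4.
  have -> : N' = n + 1 by ring.
  rewrite mulr1 !addrK; move: (invd x) (coth x) (csch2 x) (lorentz x) => y c t l.
  move: n => m y0 yc c1 c2 t0 l0 l1 ly m4.
  have cy2 : y ^+ 2 <= c ^+ 2 by rewrite ler_sqr// nnegrE ltW// (lt_le_trans y0).
  have e1 : c * (y * (2^-1 + 2^-1 * l)) <= c * c.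
    rewrite ler_wpM2l ?(le_trans ler01 c1)//; nra.
  have e2 : l ^+ 2 * (1 - y ^+ 2 / 4) <= y ^+ 2 / 4.
    have : l ^+ 2 <= y ^+ 2 / 4 by nra.
    have : 0 <= l ^+ 2 * (y ^+ 2 / 4) by rewrite mulr_ge0 ?sqr_ge0// divr_ge0 ?sqr_ge0.
    nra.
  have e3 : (m + 1) * (c * (y * (2^-1 + 2^-1 * l))) <= (m + 1) * (c * c).
    by rewrite ler_wpM2l//; lra.
  have e4 : (m - 4) * m * c ^+ 2 >= 0.
    by rewrite mulr_ge0 ?sqr_ge0// mulr_ge0//; lra.
  have e5 : (m - 4) * c ^+ 2 >= 0 by rewrite mulr_ge0 ?sqr_ge0//; lra.
  have e6 : (m + 1) * c * (m / 2 * c - y * (2^-1 + 2^-1 * l)) =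
    (m + 1) * m / 2 * c ^+ 2 - (m + 1) * (c * (y * (2^-1 + 2^-1 * l))) by ring.
  rewrite e6.
  have et : t = c ^+ 2 - 1 by rewrite c2; ring.
  rewrite et; move: e1 e2 e3 e4 e5 cy2 c1; rewrite !expr2; nra.
Qed.

End rellich.

(** * Rellich inequalities *)

Section rellich_chain.
Context {R : realType}.

(** Applied with Y = r^-2 and t = csch^2 r, so that Y / (1 + Y) is [lorentz]. The constants are
    those at n = 4, the smallest n with N > 4: multiplied by n^2/4 = 4 they become 9/16, 6 and 1,
    the last two being exactly the coefficients of t and t^2 available there. For Y <= 6/5 the last
    summand suffices; beyond, t >= Y - 1 takes over. *)
Lemma lorentz_bound (t Y : R) : 0 < Y -> 0 <= t -> Y - 1 <= t ->
  9 / 64 * Y ^+ 2 <=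
  3 / 2 * t + t ^+ 2 / 4 + (Y / (1 + Y)) ^+ 2 * (1 - Y / 4).
Proof.
move=> Y0 t0 tY; have D0 : 0 < 1 + Y by rewrite addr_gt0.
have [Ys|Ys] := lerP Y (6 / 5).
  have -> : (Y / (1 + Y)) ^+ 2 * (1 - Y / 4) = Y ^+ 2 * ((1 - Y / 4) / (1 + Y) ^+ 2).
    by field; rewrite gt_eqF.
  have h : 9 / 64 <= (1 - Y / 4) / (1 + Y) ^+ 2.
    by rewrite ler_pdivlMr ?exprn_gt0//; nra.
  have : 9 / 64 * Y ^+ 2 <= Y ^+ 2 * ((1 - Y / 4) / (1 + Y) ^+ 2).
    by rewrite mulrC ler_wpM2l// sqr_ge0.
  have := sqr_ge0 t; lra.
have l1 : Y / (1 + Y) <= 1 by rewrite ler_pdivrMr//; lra.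
have l0 : 0 <= Y / (1 + Y) by rewrite divr_ge0// ltW.
set l := Y / (1 + Y) in l1 l0 *.
have ll : l ^+ 2 <= 1 by rewrite exprn_ile1.
have ll0 : 0 <= l ^+ 2 by rewrite sqr_ge0.
have tt : (Y - 1) ^+ 2 <= t ^+ 2 by rewrite ler_sqr ?nnegrE//; lra.
have [Y4|Y4] := lerP Y 4.
  have : 0 <= l ^+ 2 * (1 - Y / 4) by rewrite mulr_ge0//; lra.
  move: tt; nra.
have : 1 - Y / 4 <= l ^+ 2 * (1 - Y / 4).
  rewrite -[leLHS]mul1r -subr_ge0 -mulrBl mulr_le0//; lra.
move: tt; nra.
Qed.

Context {N : nat}.
Variables (a : 'rV[R]_N) (kap : R).
Hypotheses (ha : hyp_space a) (kap1 : 1 < kap).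
Implicit Types u v : 'rV[R]_N -> R.

Notation hyp := (@hyp_space R N).
Notation N' := (N%:R : R).
Notation tf := (test_function hyp).
Notation invd := (invd a kap).
Notation csch2 := (csch2 a kap).
Notation n := (N' - 1).
Notation grad2 u := (inner (fun j => partial j u) (fun j => partial j u)).

(** Divergence theorem for the field u grad u. *)
Lemma dirichlet_form u : tf u ->
  hint (grad2 u) = hint (fun x => - (u x * lapl u x)).
Proof.
move=> tu; have nu := tf_nice tu; have npu j := tf_partial_nice j tu.
have nlu := tf_nice (tf_lapl tu).
have nul : nice (fun x => u x * lapl u x) by apply: niceMr => //; case: nlu.
have ng : nice (grad2 u) by apply: nice_inner => // j; case: (npu j).
have : hint (fun x => u x * lapl u x + grad2 u x) = 0.
  apply: green.
  - by move=> x j _; exact: tf_der.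
  - by case: nu.
  - by move=> j; case: (npu j).
  - by case: nu.
  - by move=> j; case: (npu j).
  - by move=> x j _; exact: tf_der2.
  - by move=> j; case: (npu j).
  - by move=> j; exact: tf_partial2_cont.
rewrite hintD// => e; have -> : (fun x => - (u x * lapl u x)) =
  fun x => -1 * (u x * lapl u x) by apply/funext => x; rewrite mulN1r.
by rewrite hintZ// mulN1r; apply/eqP; rewrite -subr_eq0 opprK addrC e.
Qed.

Let cy k : contB (fun x => invd x ^+ k).
Proof. by apply: contB_exp; exact: contB_invd. Qed.

Let nice_ul c u : tf u -> contB c -> nice (fun x => - (c x * u x * lapl u x)).
Proof.
move=> tu cc; have -> : (fun x => - (c x * u x * lapl u x)) =
  fun x => -1 * (c x * u x * lapl u x) by apply/funext => x; rewrite mulN1r.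
apply: niceZ; apply: niceMr; first by apply: niceMl => //; exact: tf_nice.
by case: (tf_nice (tf_lapl tu)).
Qed.

Let nice_u2 c u : tf u -> contB c -> nice (fun x => u x ^+ 2 * c x).
Proof. by move=> tu cc; apply: niceMr => //; apply: nice_sqr; exact: tf_nice. Qed.

(* Expanding (Delta u + (lam + csch^2) u)^2 >= 0, where lam = n^2/4, reduces
   the claim to the Hardy inequalities with weights 1 and csch^2. *)
Lemma poincare_rellich u : (4 < N)%N -> tf u ->
  hint (fun x => u x ^+ 2 * (n ^+ 2 / 16 * invd x ^+ 2 + 9 / 16 * invd x ^+ 4)) <=
  hint (fun x => lapl u x ^+ 2) - n ^+ 2 / 4 * hint (grad2 u).
Proof.
move=> N4 tu; have N2 : (2 < N)%N by apply: ltn_trans N4.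
have n4 := @n_ge R N _ N4.
rewrite dirichlet_form// -hintZ; last first.
  have -> : (fun x => - (u x * lapl u x)) = (fun x => - (1 * u x * lapl u x)).
    by apply/funext => x; rewrite mul1r.
  by apply: nice_ul => //; exact: contB_cst.
have h1 := hardy_improved ha kap1 N4 tu.
have h2 := hardy_csch2 ha kap1 N2 tu.
have cc (c : R) := @contB_cst R N c.
have ct := contB_csch2 ha kap1.
have cl : contB (lorentz a kap).
  apply: contB_inv => [|x hx].
    by apply: contB_add => //; apply: contB_exp; exact: contB_rdist.
  by rewrite gt_eqF// ltr_pwDl// sqr_ge0.
set M1 := fun x => n ^+ 2 / 4 + n * (n - 2) / 4 * csch2 x +
    invd x ^+ 2 / 4 + lorentz a kap x ^+ 2 * (1 - invd x ^+ 2 / 4).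
set M2 := fun x => csch2 x * (n ^+ 2 / 4 - 1 + (n * (n - 2) / 4 - 1) * csch2 x).
have cM1 : contB M1.
  apply: contB_add; first by
    repeat apply: contB_add => //; apply: contB_mul => //; exact: cy.
  apply: contB_mul; first exact: contB_exp.
  by apply: contB_add => //; apply: contB_opp; apply: contB_mul => //; exact: cy.
have cM2 : contB M2.
  by apply: contB_mul => //; apply: contB_add => //; exact: contB_mul.
have nL1 : nice (fun x => - (u x * lapl u x)).
  have -> : (fun x => - (u x * lapl u x)) = (fun x => - (1 * u x * lapl u x)).
    by apply/funext => x; rewrite mul1r.
  exact: nice_ul.
have nL2 : nice (fun x => - (csch2 x * u x * lapl u x)) by exact: nice_ul.
have nlu2 : nice (fun x => lapl u x ^+ 2).
  by apply: nice_sqr; exact: tf_nice (tf_lapl tu).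
pose D x := (n ^+ 2 / 4 + csch2 x) ^+ 2.
have cD : contB D by apply: contB_exp; exact: contB_add.
have nM1 : nice (fun x => u x ^+ 2 * M1 x) by exact: nice_u2.
have nM2 : nice (fun x => u x ^+ 2 * M2 x) by exact: nice_u2.
have nD : nice (fun x => u x ^+ 2 * D x) by exact: nice_u2.
rewrite lerBrDr.
(* The square provides 2 lam (- u Delta u). One copy pays for the gradient term and is left as it
   stands; the other is estimated by [hardy_improved], and the csch^2 part by [hardy_csch2]. *)
apply: (@le_trans _ _ (hint (fun x => n ^+ 2 / 4 * - (u x * lapl u x) +
    (n ^+ 2 / 4 * (u x ^+ 2 * M1 x) + 2 * (u x ^+ 2 * M2 x) +
      -1 * (u x ^+ 2 * D x))))).
  rewrite [leLHS]addrC -hintD; last 2 first.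
    by apply: niceZ.
    apply: nice_u2 => //; apply: contB_add; apply: contB_mul => //; exact: cy.
  apply: le_hint.
  - apply: niceD; first exact: niceZ.
    apply: nice_u2 => //; apply: contB_add; apply: contB_mul => //; exact: cy.
  - by apply: niceD; [exact: niceZ|repeat apply: niceD; exact: niceZ].
  move=> x hx; rewrite lerD2l /M1 /M2 /D.
  have y0 := invd_gt0 ha kap1 hx; have yc := invd_le_coth ha kap1 hx.
  have c2 := coth_sqr ha kap1 hx; have t0 := csch2_gt0 ha kap1 hx.
  have c1 := coth_ge1 ha kap1 hx; have r0 := rdist_gt0 ha kap1 hx.
  have lE : lorentz a kap x = invd x ^+ 2 / (1 + invd x ^+ 2).
    have D0 (r : R) : 1 + r ^+ 2 != 0 by rewrite gt_eqF// ltr_pwDl// sqr_ge0.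
    rewrite /lorentz /invd; field.
    by rewrite (gt_eqF r0) addrC D0.
  have ty : invd x ^+ 2 - 1 <= csch2 x.
    have : invd x ^+ 2 <= coth a kap x ^+ 2.
      by rewrite ler_sqr// nnegrE ltW// (lt_le_trans y0).
    by rewrite c2 lerBlDl.
  have := lorentz_bound (exprn_gt0 2 y0) (ltW t0) ty.
  rewrite -lE.
  (* The constants n^4/16 cancel because lam is the spectral gap of [hardy_improved]; the r^-2 term
     n^2/16 is lam times the Hardy constant 1/4. *)
  have -> : n ^+ 2 / 4 * (u x ^+ 2 * (n ^+ 2 / 4 + n * (n - 2) / 4 * csch2 x +
      invd x ^+ 2 / 4 + lorentz a kap x ^+ 2 * (1 - invd x ^+ 2 / 4))) +
    2 * (u x ^+ 2 * (csch2 x * (n ^+ 2 / 4 - 1 + (n * (n - 2) / 4 - 1) * csch2 x))) +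
    -1 * (u x ^+ 2 * (n ^+ 2 / 4 + csch2 x) ^+ 2) =
   u x ^+ 2 * (n ^+ 2 / 16 * invd x ^+ 2 +
     ((n ^+ 2 / 4 * (n * (n - 2) / 4) - 2) * csch2 x +
      (n * (n - 2) / 2 - 3) * csch2 x ^+ 2 +
      n ^+ 2 / 4 * (lorentz a kap x ^+ 2 * (1 - invd x ^+ 2 / 4)))) by field.
  move=> lb; apply: ler_wpM2l; first exact: sqr_ge0.
  rewrite lerD2l.
  have {}lb := ler_wpM2l (_ : 0 <= n ^+ 2 / 4) lb.
  have n20 : 0 <= n ^+ 2 / 4 by rewrite divr_ge0// sqr_ge0.
  move: {lb} (lb n20); set L := lorentz a kap x ^+ 2 * _.
  rewrite -[invd x ^+ 4]/(invd x ^+ (2 * 2)) exprM.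
  set Y := (invd x ^+ 2) ^+ 2; have Y0 : 0 <= Y by exact: sqr_ge0.
  move: t0 n4; move: (csch2 x) n => t m t0 m4 lb.
  (* Termwise comparison with n^2/4 times [lorentz_bound]; each of [e1], [e2], [e3] is an equality
     at n = 4. *)
  have e1 : 9 / 16 * Y <= m ^+ 2 / 4 * (9 / 64 * Y).
    have : (4 ^+ 2) * Y <= m ^+ 2 * Y by rewrite ler_wpM2r// ler_sqr// nnegrE; lra.
    lra.
  have m8 : 8 <= m * (m - 2) by nra.
  have m16 : 16 <= m ^+ 2 by nra.
  have e2 : m ^+ 2 / 4 * (3 / 2 * t) <= (m ^+ 2 / 4 * (m * (m - 2) / 4) - 2) * t.
    have : 0 <= (m ^+ 2 / 4 * (m * (m - 2) / 4) - 2 - m ^+ 2 / 4 * (3 / 2)) * t.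
      apply: mulr_ge0; last exact: ltW.
      have : 0 <= (m ^+ 2 - 16) * (m * (m - 2) - 8) by rewrite mulr_ge0//; lra.
      lra.
    lra.
  have e3 : m ^+ 2 / 4 * (t ^+ 2 / 4) <= (m * (m - 2) / 2 - 3) * t ^+ 2.
    have : 0 <= (m * (m - 2) / 2 - 3 - m ^+ 2 / 16) * t ^+ 2.
      by apply: mulr_ge0; [nra|exact: sqr_ge0].
    lra.
  lra.
apply: (@le_trans _ _ (hint (fun x => n ^+ 2 / 4 * - (u x * lapl u x) +
    (n ^+ 2 / 4 * (- (u x * lapl u x)) + 2 * (- (csch2 x * u x * lapl u x)) +
      -1 * (u x ^+ 2 * D x))))).
  have nZ c f : nice f -> nice (fun x => c * f x) := @niceZ _ _ c f.
  rewrite !hintD; try by repeat (apply: niceD || apply: nZ).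
  rewrite !hintZ// lerD2l lerD2r lerD//.
    by rewrite ler_wpM2l// divr_ge0// sqr_ge0.
  by rewrite ler_wpM2l.
apply: le_hint => //.
  by repeat (apply: niceD || apply: niceZ).
move=> x _; rewrite /D -subr_ge0.
have -> : lapl u x ^+ 2 - (n ^+ 2 / 4 * - (u x * lapl u x) +
   (n ^+ 2 / 4 * - (u x * lapl u x) + 2 * - (csch2 x * u x * lapl u x) +
    -1 * (u x ^+ 2 * (n ^+ 2 / 4 + csch2 x) ^+ 2))) =
   (lapl u x + (n ^+ 2 / 4 + csch2 x) * u x) ^+ 2 by ring.
exact: sqr_ge0.
Qed.

Lemma poincare_hardy u : (2 < N)%N -> tf u ->
  4^-1 * hint (fun x => u x ^+ 2 * invd x ^+ 2) <=
  hint (grad2 u) - n ^+ 2 / 4 * hint (fun x => u x ^+ 2).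
Proof.
move=> N2 tu; rewrite dirichlet_form// lerBrDr.
apply: le_trans (hardy_zero ha kap1 N2 tu).
rewrite -[4^-1 * _]hintZ; last exact: (nice_u2 tu (@cy 2)).
rewrite -[n ^+ 2 / 4 * _]hintZ; last by apply: nice_sqr; exact: tf_nice.
rewrite -hintD; [|by apply: niceZ; exact: (nice_u2 tu (@cy 2))|
  by apply: niceZ; apply: nice_sqr; exact: tf_nice].
rewrite le_eqVlt; apply/orP; left; apply/eqP; congr hint.
by apply/funext => x; ring.
Qed.

(* Expanding (Delta u + psi u)^2 invd^k >= 0 with psi = c invd^2 + d. *)
Lemma rellich_square k (c d : R) u : (2 < N)%N -> (0 < k)%N -> 0 <= c -> 0 <= d ->
  tf u ->
  2 * c * hint (fun x => u x ^+ 2 *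
     (@rellich_const R N k.+2 * invd x ^+ k.+4 + n / 2 * invd x ^+ k.+2)) +
  2 * d * hint (fun x => u x ^+ 2 *
     (@rellich_const R N k * invd x ^+ k.+2 + n / 2 * invd x ^+ k)) -
  hint (fun x => u x ^+ 2 * ((c * invd x ^+ 2 + d) ^+ 2 * invd x ^+ k)) <=
  hint (fun x => lapl u x ^+ 2 * invd x ^+ k).
Proof.
move=> N2 k0 c0 d0 tu; rewrite lerBlDr.
have cc (b : R) := @contB_cst R N b.
have nlu : nice (lapl u) := tf_nice (tf_lapl tu).
have nS : nice (fun x => u x ^+ 2 * ((c * invd x ^+ 2 + d) ^+ 2 * invd x ^+ k)).
  apply: nice_u2 => //; apply: contB_mul => //; apply: contB_exp.
  by apply: contB_add => //; exact: contB_mul.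
have nl2 : nice (fun x => lapl u x ^+ 2 * invd x ^+ k).
  by apply: niceMr => //; exact: nice_sqr.
have n1 := nice_ul tu (@cy k.+2); have n2 := nice_ul tu (@cy k).
apply: (@le_trans _ _ (2 * c * hint (fun x => - (invd x ^+ k.+2 * u x * lapl u x)) +
  2 * d * hint (fun x => - (invd x ^+ k * u x * lapl u x)))).
  by apply: lerD; (apply: ler_wpM2l; [exact: mulr_ge0|exact: hardy_power]).
rewrite -!hintZ// -!hintD//; try exact: niceZ.
apply: le_hint.
- by apply: niceD; exact: niceZ.
- exact: niceD.
move=> x hx; rewrite -subr_ge0.
have -> : lapl u x ^+ 2 * invd x ^+ k +
   u x ^+ 2 * ((c * invd x ^+ 2 + d) ^+ 2 * invd x ^+ k) -
   (2 * c * - (invd x ^+ k.+2 * u x * lapl u x) +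
    2 * d * - (invd x ^+ k * u x * lapl u x)) =
   (lapl u x + (c * invd x ^+ 2 + d) * u x) ^+ 2 * invd x ^+ k.
  by rewrite !exprS; ring.
by rewrite mulr_ge0 ?sqr_ge0// exprn_ge0// ltW// (invd_gt0 ha kap1).
Qed.

Lemma rellich_constE k : @rellich_const R N k.+2 = (N' - k%:R - 4) * (N' + k%:R) / 4.
Proof. by rewrite /rellich_const -[k.+2%:R]natr1 -[k.+1%:R]natr1; field. Qed.

Lemma rellich_const_ge0 k : (k.+4 <= N)%N -> 0 <= @rellich_const R N k.+2.
Proof.
move=> kN; have : k.+4%:R <= N' by rewrite ler_nat.
rewrite -natr1 -[k.+3%:R]natr1 -[k.+2%:R]natr1 -[k.+1%:R]natr1 => h.
have k0 : 0 <= k%:R :> R by [].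
by rewrite rellich_constE divr_ge0// mulr_ge0//; lra.
Qed.

Lemma hint_ge0 f : (forall x, hyp x -> 0 <= f x) -> supp0 f -> 0 <= hint f.
Proof.
move=> f0 sf; apply: Int_ge0 => x; have [hx|hx] := pselect (hyp x).
  by rewrite mulr_ge0 ?f0 // ltW// dens_gt0.
by rewrite (supp0_0 sf hx) mul0r.
Qed.

Lemma hint_u2_ge0 k u : tf u -> 0 <= hint (fun x => u x ^+ 2 * invd x ^+ k).
Proof.
move=> tu; apply: hint_ge0 => [x hx|]; last by case: (nice_u2 tu (@cy k)).
by rewrite mulr_ge0 ?sqr_ge0// exprn_ge0// ltW// (invd_gt0 ha kap1).
Qed.

Lemma le_hint_u2 k (M : 'rV[R]_N -> R) u : tf u -> contB M -> forall c,
  (forall x, hyp x -> c * invd x ^+ k <= M x) ->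
  c * hint (fun x => u x ^+ 2 * invd x ^+ k) <= hint (fun x => u x ^+ 2 * M x).
Proof.
move=> tu cM c h; rewrite -hintZ; last exact: (nice_u2 tu (@cy k)).
apply: le_hint => [||x hx]; first by apply: niceZ; exact: (nice_u2 tu (@cy k)).
  exact: nice_u2.
by rewrite mulrCA ler_wpM2l ?sqr_ge0// h.
Qed.

(** [rellich_square] with d = 0. The gain 2 c C - c^2 is maximal at c = C, the Rellich constant
    itself; the extra r^(-k-2) term is dropped. *)
Lemma rellich_power k u : (0 < k)%N -> (k.+4 <= N)%N -> tf u ->
  @rellich_const R N k.+2 ^+ 2 * hint (fun x => u x ^+ 2 * invd x ^+ k.+4) <=
  hint (fun x => lapl u x ^+ 2 * invd x ^+ k).
Proof.
move=> k0 kN tu; have N2 : (2 < N)%N by rewrite (leq_trans _ kN).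
have C0 := rellich_const_ge0 kN.
have n2 := @n_ge R N _ N2; have n0 : 0 <= n by rewrite (le_trans _ n2).
apply: le_trans (rellich_square N2 k0 C0 (lexx 0) tu).
rewrite mulr0 mul0r addr0.
have cc (b : R) := @contB_cst R N b.
have h := @le_hint_u2 k.+4 (fun x => @rellich_const R N k.+2 * invd x ^+ k.+4 +
  n / 2 * invd x ^+ k.+2) _ tu _ (@rellich_const R N k.+2) _.
have {}h := h (contB_add (contB_mul (cc _) (@cy _)) (contB_mul (cc _) (@cy _))).
have -> : (fun x => u x ^+ 2 * ((@rellich_const R N k.+2 * invd x ^+ 2 + 0) ^+ 2 *
    invd x ^+ k)) =
  fun x => @rellich_const R N k.+2 ^+ 2 * (u x ^+ 2 * invd x ^+ k.+4).
  by apply/funext => x; rewrite [invd x ^+ k.+4](exprD _ 4 k); ring.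
rewrite hintZ; last exact: (nice_u2 tu (@cy _)).
rewrite -mulrA lerBrDr.
apply: (@le_trans _ _ (2 * (@rellich_const R N k.+2 *
  (@rellich_const R N k.+2 * hint (fun x => u x ^+ 2 * invd x ^+ k.+4))))).
  by rewrite expr2 -!mulrA; lra.
rewrite !ler_wpM2l//; apply: h => x hx.
rewrite lerDl mulr_ge0 ?divr_ge0// exprn_ge0// ltW// (invd_gt0 ha kap1)//.
Qed.

(** [rellich_square] with k = 2, c the Rellich constant and d = n/4. The r^-2 coefficient n d - d^2
    = 3 n^2/16 exceeds the required n^2/16 by n^2/8, and the r^-4 terms are nonnegative, so r^-2 and
    r^-6 survive together. *)
Lemma rellich_two u : (6 < N)%N -> tf u ->
  n ^+ 2 / 16 * hint (fun x => u x ^+ 2 * invd x ^+ 2) +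
  @rellich_const R N 4 ^+ 2 * hint (fun x => u x ^+ 2 * invd x ^+ 6) <=
  hint (fun x => lapl u x ^+ 2 * invd x ^+ 2).
Proof.
move=> N6 tu; have N2 : (2 < N)%N by apply: ltn_trans N6.
have C0 : 0 <= @rellich_const R N 4 by apply: rellich_const_ge0; exact: ltnW.
have n2 := @n_ge R N _ N2; have n0 : 0 <= n by rewrite (le_trans _ n2).
have d0 : 0 <= n / 4 by rewrite divr_ge0.
apply: le_trans (rellich_square N2 (isT : (0 < 2)%N) C0 d0 tu).
have cc (b : R) := @contB_cst R N b.
have cM k l : contB (fun x => @rellich_const R N k * invd x ^+ l +
  n / 2 * invd x ^+ k) by
  exact: contB_add (contB_mul (cc _) (@cy _)) (contB_mul (cc _) (@cy _)).
have cS : contB (fun x => (@rellich_const R N 4 * invd x ^+ 2 + n / 4) ^+ 2 * invd x ^+ 2).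
  apply: contB_mul => //; apply: contB_exp.
  by apply: contB_add => //; exact: contB_mul.
have nn k := nice_u2 tu (@cy k).
have nM k l := nice_u2 tu (cM k l).
have nS := nice_u2 tu cS.
rewrite -!hintZ// -hintD; [|exact: niceZ..].
rewrite -hintD; [|exact: niceZ..].
rewrite lerBrDr -hintD//; last by apply: niceD; exact: niceZ.
apply: le_hint.
- by apply: niceD => //; apply: niceD; exact: niceZ.
- by apply: niceD; exact: niceZ.
move=> x hx.
have y0 := invd_gt0 ha kap1 hx.
have Cl : @rellich_const R N 4 <= @rellich_const R N 2.
  by rewrite /rellich_const; lra.
rewrite -subr_ge0.
have -> : 2 * @rellich_const R N 4 * (u x ^+ 2 *
    (@rellich_const R N 4 * invd x ^+ 6 + n / 2 * invd x ^+ 4)) +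
   2 * (n / 4) * (u x ^+ 2 *
    (@rellich_const R N 2 * invd x ^+ 4 + n / 2 * invd x ^+ 2)) -
   (n ^+ 2 / 16 * (u x ^+ 2 * invd x ^+ 2) +
    @rellich_const R N 4 ^+ 2 * (u x ^+ 2 * invd x ^+ 6) +
    u x ^+ 2 * ((@rellich_const R N 4 * invd x ^+ 2 + n / 4) ^+ 2 * invd x ^+ 2)) =
   u x ^+ 2 * (invd x ^+ 4 * (n / 2 * @rellich_const R N 4 +
     n / 2 * @rellich_const R N 2) +
     invd x ^+ 2 * (n ^+ 2 / 8)) by field.
rewrite mulr_ge0 ?sqr_ge0// addr_ge0// mulr_ge0 ?exprn_ge0 ?(ltW y0)//.
  have h0 : 0 <= n / 2 by rewrite divr_ge0.
  by apply: addr_ge0; apply: mulr_ge0 => //; exact: le_trans C0 Cl.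
by rewrite divr_ge0// sqr_ge0.
Qed.

(** The weight r^-2 reproduces itself in [rellich_two], whose r^-6 term is dropped at each step. *)
Lemma chain_two m u : (6 < N)%N -> tf u ->
  (n ^+ 2 / 16) ^+ m * hint (fun x => u x ^+ 2 * invd x ^+ 2) <=
  hint (fun x => iter m lapl u x ^+ 2 * invd x ^+ 2).
Proof.
move=> N6 tu; elim: m => [|m IH] /=; first by rewrite expr0 mul1r.
have tv := tf_iter m tu.
apply: le_trans (rellich_two N6 tv); rewrite exprS -mulrA.
apply: ler_wpDr; first by rewrite mulr_ge0 ?sqr_ge0 ?hint_u2_ge0.
by apply: ler_wpM2l => //; rewrite divr_ge0 ?sqr_ge0.
Qed.

(** The outermost Laplacian is removed first and raises the weight from k to k + 4, so the induction
    on [m] must hold for all [k]. *)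
Lemma chain_power m k u : (0 < k)%N -> (4 * m + k <= N)%N -> tf u ->
  (\prod_(i < m) @rellich_const R N (4 * i + k).+2 ^+ 2) *
    hint (fun x => u x ^+ 2 * invd x ^+ (4 * m + k)) <=
  hint (fun x => iter m lapl u x ^+ 2 * invd x ^+ k).
Proof.
elim: m k => [|m IH] k k0 kN tu /=; first by rewrite big_ord0 mul1r.
have tv := tf_iter m tu.
have kN4 : (k.+4 <= N)%N.
  by apply: leq_trans kN; rewrite -[k.+4]/(4 + k)%N leq_add2r leq_pmulr.
apply: le_trans (rellich_power k0 kN4 tv).
rewrite big_ord_recl /= muln0 add0n -mulrA ler_wpM2l ?sqr_ge0//.
have e : (4 * m + k.+4 = 4 * m.+1 + k)%N.
  by rewrite mulnS -[k.+4]/(4 + k)%N addnCA addnA.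
have := IH k.+4 isT; rewrite e => /(_ kN tu); apply: le_trans.
rewrite le_eqVlt; apply/orP; left; apply/eqP; congr (_ * _).
apply: eq_bigr => i _; congr (@rellich_const R N _ ^+ 2).
by rewrite /bump /= mulnDr muln1 addnAC addnC !addnS.
Qed.

End rellich_chain.

(** * Length of curves *)

Section curve_length.
Context {R : realType} {N : nat}.
Variables (a : 'rV[R]_N) (kap : R).
Hypotheses (ha : hyp_space a) (kap1 : 1 < kap).

Notation hyp := (@hyp_space R N).
Notation rad := (rad a kap).
Notation drad := (drad a kap).
Notation rdist := (rdist a kap).

Lemma metric_sqnormE (x v : 'rV[R]_N) :
  metric_sqnorm (@hyp_metric R N) x v = (eta x)^-1 ^+ 2 * \sum_j v 0 j ^+ 2.
Proof.
rewrite /metric_sqnorm hyp_metricE mul_mx_scalar -scalemxAl !mxE.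
by congr (_ * _); apply: eq_bigr => j _; rewrite !mxE expr2.
Qed.

(** The bound [K] stands in for the sum of p^2, which vanishes at the pole in the application,
    whereas [K] stays positive. *)
Lemma sum_cauchy_schwarz (p q : 'I_N -> R) (K : R) :
  0 < K -> \sum_j p j ^+ 2 <= K ->
  (\sum_j p j * q j) ^+ 2 <= K * \sum_j q j ^+ 2.
Proof.
move=> K0 hK.
have e (E : R) : \sum_j (K * q j - E * p j) ^+ 2 =
    K ^+ 2 * (\sum_j q j ^+ 2) - 2 * K * E * (\sum_j p j * q j) +
    E ^+ 2 * \sum_j p j ^+ 2.
  rewrite !mulr_sumr -sumrB -big_split /=.
  by apply: eq_bigr => j _; ring.
have := e (\sum_j p j * q j).
set E := \sum_j p j * q j; set B := \sum_j q j ^+ 2.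
have : 0 <= \sum_j (K * q j - E * p j) ^+ 2.
  by apply: sumr_ge0 => j _; exact: sqr_ge0.
move=> /[swap] ->.
have h : E ^+ 2 * \sum_j p j ^+ 2 <= E ^+ 2 * K by rewrite ler_wpM2l ?sqr_ge0.
move=> h0; rewrite -subr_ge0 -(pmulr_rge0 _ K0); nra.
Qed.

Variable c : R -> 'rV[R]_N.
Hypothesis dc : forall s, derivable c s 1.
Hypothesis cc : continuous (derive1 c).
Hypothesis hc : forall s, 0 <= s <= 1 -> hyp (c s).

Let der_c j (s : R) : is_derive s 1 (fun t => c t 0 j) (derive1 c s 0 j).
Proof.
split; first by move/derivable_mxP : (@dc s); exact.
by rewrite derive1E derive_mx// mxE.
Qed.

Let c_cont : continuous c.
Proof.
by move=> s; apply: differentiable_continuous; apply/derivable1_diffP.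
Qed.

(** Partial derivatives alone give no chain rule along a curve, so the explicit formula of [rad] is
    differentiated once more along [c]. *)
Let der_rad_c (s : R) : hyp (c s) ->
  is_derive s 1 (fun t => rad (c t)) (\sum_j drad j (c s) * derive1 c s 0 j).
Proof.
move=> hs; have h0 : eta (c s) != 0 by rewrite gt_eqF// eta_gt0.
have B0 : 1 - euclid_sqnorm a != 0 by rewrite gt_eqF// subr_gt0.
have d1 : is_derive s 1 (fun t => euclid_sqnorm (c t))
    (\sum_j 2 * c s 0 j * derive1 c s 0 j).
  by apply: der_sum => j; apply: der_sqr; exact: der_c.
have d2 : is_derive s 1 (fun t => euclid_sqnorm (c t - a))
    (\sum_j 2 * (c s 0 j - a 0 j) * derive1 c s 0 j).
  rewrite (_ : (fun t => _) = fun t => \sum_j (c t 0 j + - a 0 j) ^+ 2); last first.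
    by apply/funext => t; apply: eq_bigr => j _; rewrite !mxE.
  apply: der_sum => j.
  apply: (is_derive_eq (der_sqr (der_add (der_c j s) (der_cst (- a 0 j) s 1)))).
  by rewrite addr0.
have d3 := der_mul (der_add (der_cst 1 s 1) (der_opp d1)) (der_cst 2^-1 s 1).
have h := der_scale kap (der_add (der_cst 1 s 1) (der_mul
  (der_mul d2 (der_inv d3 h0)) (der_cst (1 - euclid_sqnorm a)^-1 s 1))).
apply: (is_derive_eq h).
have -> : \sum_j drad j (c s) * derive1 c s 0 j = kap / (1 - euclid_sqnorm a) *
  ((\sum_j 2 * (c s 0 j - a 0 j) * derive1 c s 0 j) / eta (c s) +
   euclid_sqnorm (c s - a) * (eta (c s))^-1 ^+ 2 / 2 *
   (\sum_j 2 * c s 0 j * derive1 c s 0 j)).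
  rewrite mulr_suml !mulr_sumr -big_split /= mulr_sumr.
  by apply: eq_bigr => j _; rewrite /drad; field; rewrite h0.
by rewrite -[(1 - euclid_sqnorm (c s)) / 2]/(eta (c s)); field; rewrite h0.
Qed.

Let speed (s : R) := (eta (c s))^-1 * Num.sqrt (\sum_j derive1 c s 0 j ^+ 2).

Let speedE (s : R) : hyp (c s) ->
  Num.sqrt (metric_sqnorm (@hyp_metric R N) (c s) (derive1 c s)) = speed s.
Proof.
move=> hs; rewrite metric_sqnormE sqrtrM ?sqr_ge0// sqrtr_sqr ger0_norm//.
by rewrite invr_ge0 ltW// eta_gt0.
Qed.

Let dpsi (s : R) := (sh (rad (c s)))^-1 * \sum_j drad j (c s) * derive1 c s 0 j.

(** [dpsi] is the derivative of [rdist] along [c]; this is |grad r| <= 1, obtained from |grad q|^2 =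
    q^2 - kap^2 <= sh^2 by Cauchy-Schwarz. *)
Let dpsi_le (s : R) : hyp (c s) -> - dpsi s <= speed s.
Proof.
move=> hs; have q1 := rad_gt1 ha kap1 hs; have s0 := sh_gt0 q1.
have e0 := eta_gt0 hs.
apply: le_trans (ler_norm _) _; rewrite normrN.
rewrite -ler_sqr ?nnegrE ?mulr_ge0 ?invr_ge0 ?sqrtr_ge0 ?(ltW e0)//.
rewrite real_normK ?num_real// !exprMn sqr_sqrtr; last first.
  by apply: sumr_ge0 => j _; exact: sqr_ge0.
have K0 : 0 < sh (rad (c s)) ^+ 2 * (eta (c s))^-1 ^+ 2.
  by rewrite mulr_gt0 ?exprn_gt0// invr_gt0.
have hK : \sum_j drad j (c s) ^+ 2 <= sh (rad (c s)) ^+ 2 * (eta (c s))^-1 ^+ 2.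
  have := inner_drad kap ha hs; rewrite /inner => e.
  rewrite -(ler_pM2l (exprn_gt0 2 e0)).
  under eq_bigr do rewrite expr2; rewrite e mulrCA -exprMn divff ?gt_eqF//.
  by rewrite expr1n mulr1 sh_sqr// lerB// exprn_ege1 // ltW.
have := sum_cauchy_schwarz (fun j => derive1 c s 0 j) K0 hK.
move=> /(ler_wpM2l (_ : 0 <= (sh (rad (c s)))^-1 ^+ 2)); rewrite sqr_ge0 => /(_ isT).
move=> /le_trans; apply; rewrite le_eqVlt; apply/orP; left; apply/eqP.
by field; rewrite !gt_eqF.
Qed.

Let in01 (s : R) : s \in `[0, 1] -> hyp (c s).
Proof. by rewrite in_itv/=; exact: hc. Qed.

Let contB_c (f : 'rV[R]_N -> R) (s : R) : contB f -> hyp (c s) ->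
  {for s, continuous (fun t => f (c t))}.
Proof. by move=> cf hs; apply: continuous_comp; [exact: c_cont|exact: cf]. Qed.

Let cont_dc j : continuous (fun t => derive1 c t 0 j).
Proof.
move=> s; exact: (@continuous_comp _ _ _ (derive1 c) (fun M : 'rV[R]_N => M 0 j) s
  (@cc s) (@coord_continuous R 1 N 0 j _)).
Qed.

Let cont_sum (f : 'I_N -> R -> R) (s : R) :
  (forall j, {for s, continuous (f j)}) ->
  {for s, continuous (fun t => \sum_j f j t)}.
Proof.
move=> cf; elim: (index_enum _) => [|i r IH].
  have -> : (fun t => \sum_(j <- [::]) f j t) = fun=> 0.
    by apply/funext => t; rewrite big_nil.
  exact: cst_continuous.
have -> : (fun t => \sum_(j <- i :: r) f j t) =
    fun t => f i t + \sum_(j <- r) f j t.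
  by apply/funext => t; rewrite big_cons.
exact: (cvgD (cf i) IH).
Qed.

Let cont_dpsi (s : R) : hyp (c s) -> {for s, continuous dpsi}.
Proof.
move=> hs.
have h1 : {for s, continuous (fun t => (sh (rad (c t)))^-1)}.
  apply: (contB_c (f := fun x => (sh (rad x))^-1)) => //.
  apply: contB_inv => [|x hx]; first exact: contB_sh.
  by rewrite gt_eqF// (sh_rad_gt0 ha kap1).
have h2 : {for s, continuous (fun t => \sum_j drad j (c t) * derive1 c t 0 j)}.
  apply: cont_sum => j.
  have h : {for s, continuous (fun t => drad j (c t))}.
    by apply: (contB_c (f := drad j)) => //; exact: contB_drad.
  exact: (cvgM h (@cont_dc j s)).
exact: (cvgM h1 h2).
Qed.

Let cont_speed (s : R) : hyp (c s) -> {for s, continuous speed}.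
Proof.
move=> hs.
have h1 : {for s, continuous (fun t => (eta (c t))^-1)}.
  by apply: (contB_c (f := fun x => (eta x)^-1)) => //; exact: contB_etaV.
have h2 : {for s, continuous (fun t => \sum_j derive1 c t 0 j ^+ 2)}.
  by apply: cont_sum => j; exact: (cvgM (@cont_dc j s) (@cont_dc j s)).
have h3 : {for s, continuous (fun t => Num.sqrt (\sum_j derive1 c t 0 j ^+ 2))}.
  exact: (@continuous_comp _ _ _ (fun t => \sum_j derive1 c t 0 j ^+ 2)
    (@Num.sqrt R) s h2 (@sqrt_continuous R _)).
exact: (cvgM h1 h3).
Qed.

(** Integration of [dpsi_le] over [0, 1] by the fundamental theorem of calculus. *)
Lemma curve_length_ge :
  rdist (c 0) - rdist (c 1) <= curve_length (@hyp_metric R N) c.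
Proof.
have der_psi (s : R) : hyp (c s) -> is_derive s 1 (fun t => - rdist (c t)) (- dpsi s).
  move=> hs; have q1 := rad_gt1 ha kap1 hs.
  exact: (der_opp (der_chain (der_rad_c hs) (der_arc q1))).
have within (f : R -> R) : (forall s, hyp (c s) -> {for s, continuous f}) ->
    {within `[0, 1], continuous f}.
  move=> cf; apply: continuous_in_subspaceT => s; rewrite inE /= => hs.
  by apply: cf; exact: in01.
have cN (s : R) : hyp (c s) -> {for s, continuous (fun s => - dpsi s)}.
  by move=> hs; exact: (cvgN (cont_dpsi hs)).
have ftc : (\int[lebesgue_measure]_(s in `[0%R, 1%R]) (- dpsi s)%:E =
    (- rdist (c 1))%:E - (- rdist (c 0))%:E)%E.
  apply: (@continuous_FTC2 R (fun s => - dpsi s) (fun t => - rdist (c t)) 0 1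
    ltr01 (within _ cN)).
  - split=> [s|  |].
    + rewrite in_itv/= => /andP[s0 s1].
      by case: (der_psi s) => //; apply: hc; rewrite !ltW.
    + apply: cvg_at_right_filter; apply: der_continuous (der_psi 0 _).
      by apply: hc; rewrite lexx ler01.
    + apply: cvg_at_left_filter; apply: der_continuous (der_psi 1 _).
      by apply: hc; rewrite lexx ler01.
  - move=> s; rewrite in_itv/= => /andP[s0 s1].
    by rewrite derive1E; case: (der_psi s) => //; apply: hc; rewrite !ltW.
have -> : rdist (c 0) - rdist (c 1) =
    \int[lebesgue_measure]_(s in `[0, 1]) (- dpsi s).
  by rewrite /Rintegral ftc -EFinB /fine opprK addrC.
have -> : curve_length (@hyp_metric R N) c =
    \int[lebesgue_measure]_(s in `[0, 1]) speed s.
  apply: eq_Rintegral => s; rewrite inE /= => hs.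
  by rewrite speedE//; exact: in01.
apply: le_Rintegral => //.
- apply: continuous_compact_integrable; [exact: segment_compact|exact: within].
- apply: continuous_compact_integrable; [exact: segment_compact|exact: within].
- by move=> s /= hs; apply: dpsi_le; exact: in01.
Qed.

End curve_length.

(** * Comparison of the geodesic with the regularised distance *)

Section distance.
Context {R : realType} {N : nat}.
Variables (a : 'rV[R]_N).
Hypotheses (ha : hyp_space a).

Let curves (x : 'rV[R]_N) := [set L | exists c : R -> 'rV[R]_N,
    [/\ forall s, derivable c s 1,
        continuous (derive1 c),
        forall s, 0 <= s <= 1 -> hyp_space (c s),
        c 0 = x /\ c 1 = a &
        L = curve_length (@hyp_metric R N) c]].

Lemma hyp_dist_ge0 (x : 'rV[R]_N) : 0 <= hyp_dist x a.
Proof.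
have [e|ne] := pselect (curves x !=set0); last first.
  by rewrite /hyp_dist /geodesic_dist -/(curves x) inf_out// => -[].
apply: lb_le_inf => // _ [c [_ _ _ _ ->]].
by apply: Rintegral_ge0 => s _; exact: sqrtr_ge0.
Qed.

(* The infimum of an empty set of lengths would be 0, hence the assumption that
   the distance is nonzero; at distance 0 the weight 1 / hyp_dist is 0. *)
Lemma hyp_dist_ge (kap : R) (x : 'rV[R]_N) : 1 < kap -> hyp_dist x a != 0 ->
  rdist a kap x - rdist a kap a <= hyp_dist x a.
Proof.
move=> kap1; have [e _|ne] := pselect (curves x !=set0); last first.
  by rewrite /hyp_dist /geodesic_dist -/(curves x) inf_out ?eqxx// => -[].
apply: lb_le_inf => // _ [c [dc cc hc [c0 c1] ->]].
by rewrite -[X in rdist _ _ X - _]c0 -[X in _ - rdist _ _ X]c1 curve_length_ge.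
Qed.

End distance.

(** * Removing the regularisation *)

Section pole_limit.
Context {R : realType} {N : nat}.
Variables (a : 'rV[R]_N).
Hypotheses (ha : hyp_space a).
Implicit Types u v : 'rV[R]_N -> R.

Notation hyp := (@hyp_space R N).
Notation N' := (N%:R : R).
Notation tf := (test_function hyp).

(** Integrals of nonnegative functions are suprema over simple functions below them, so monotonicity
    is available for integrands containing [hyp_dist], whose measurability is not established. *)
Lemma le_integralT_ge0 d (T : measurableType d)
    (mu : {measure set T -> \bar R}) (f g : T -> \bar R) :
  (forall x, 0 <= f x)%E -> (forall x, f x <= g x)%E ->
  (\int[mu]_x f x <= \int[mu]_x g x)%E.
Proof.
move=> f0 fg; have g0 x : (0 <= g x)%E by exact: le_trans (f0 x) (fg x).
rewrite !ge0_integralTE//; apply: ereal_sup_le => _ [h hf <-].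
by exists h => // x; exact: le_trans (hf x) (fg x).
Qed.

Definition kap_ (i : nat) : R := 1 + i.+1%:R^-1.

Lemma kap_gt1 i : 1 < kap_ i.
Proof. by rewrite ltrDl invr_gt0. Qed.

Lemma kap_cvg : kap_ i @[i --> \oo] --> (1 : R).
Proof.
rewrite -[X in _ --> X]addr0; apply: cvgD; first exact: cvg_cst.
exact: cvg_harmonic.
Qed.

Lemma arc_kap_cvg : arc (kap_ i) @[i --> \oo] --> (0 : R).
Proof.
have -> : (0 : R) = arc 1 by rewrite /arc /sh expr1n subrr sqrtr0 addr0 ln1.
apply: (@cvg_comp _ _ _ kap_ arc _ _ _ kap_cvg).
have cs : {for (1 : R), continuous (@sh R)}.
  apply: (@continuous_comp _ _ _ (fun q : R => q ^+ 2 - 1) (@Num.sqrt R) 1).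
    exact: (cvgB (cvgM cvg_id cvg_id) (cvg_cst (1 : R))).
  exact: sqrt_continuous.
have cq : {for (1 : R), continuous (fun q : R => q + sh q)}.
  exact: (cvgD cvg_id cs).
apply: (@continuous_comp _ _ _ (fun q : R => q + sh q) (@ln R) 1 cq).
by apply: continuous_ln; rewrite /sh expr1n subrr sqrtr0 addr0 ltr01.
Qed.

Lemma rdist_pole kap : rdist a kap a = arc kap.
Proof.
rewrite /rdist /rad subrr /euclid_sqnorm big1 ?mul0r ?addr0 ?mulr1// => i _.
by rewrite mxE expr0n.
Qed.

Let wt k (i : nat) u (x : 'rV[R]_N) : R :=
  u x ^+ 2 * invd a (kap_ i) x ^+ k * dens x.

(** arccosh is increasing and kap decreases along the sequence; this monotonicity is what monotone
    convergence uses. *)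
Lemma invd_mono x i j : hyp x -> (i <= j)%N ->
  invd a (kap_ i) x <= invd a (kap_ j) x.
Proof.
move=> hx ij; rewrite lef_pV2 ?posrE ?(rdist_gt0 ha (kap_gt1 _))//.
apply: arc_mono; first exact: (rad_gt1 ha (kap_gt1 _)).
rewrite /rad ler_wpM2r//.
  have e0 := eta_gt0 hx.
  by rewrite addr_ge0// !mulr_ge0 ?invr_ge0 ?sqnormB_ge0// ltW// subr_gt0.
by rewrite /kap_ lerD2l lef_pV2 ?posrE// ler_nat ltnS.
Qed.

Let wt_ge0 k i u x : tf u -> 0 <= wt k i u x.
Proof.
move=> tu; have [hx|hx] := pselect (hyp x); last first.
  by rewrite /wt (supp0_0 (tf_supp0 tu) hx) expr0n /= !mul0r.
apply: mulr_ge0; last by rewrite ltW// dens_gt0.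
rewrite mulr_ge0 ?sqr_ge0// exprn_ge0// ltW//.
exact: (invd_gt0 ha (kap_gt1 i) hx).
Qed.

Let wt_mono k i j u x : tf u -> (i <= j)%N -> wt k i u x <= wt k j u x.
Proof.
move=> tu ij; have [hx|hx] := pselect (hyp x); last first.
  by rewrite /wt (supp0_0 (tf_supp0 tu) hx) expr0n /= !mul0r.
apply: ler_wpM2r; first by rewrite ltW// dens_gt0.
apply: ler_wpM2l; first exact: sqr_ge0.
by apply: lerXn2r; rewrite ?nnegrE ?invd_mono// ltW// (invd_gt0 ha (kap_gt1 _) hx).
Qed.

(** From r(x) <= d + arccosh kap, each weight is at least (d + arccosh kap)^-k, which tends to d^-k.
    At d = 0 the left side is 0, as the inverse of 0 is 0. *)
Let dist_le_lim k u x : (0 < k)%N -> tf u -> hyp x ->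
  ((u x ^+ 2 / hyp_dist x a ^+ k * dens x)%:E <=
   limn (fun i => (wt k i u x)%:E))%E.
Proof.
move=> k0 tu hx; set d := hyp_dist x a.
have cw : cvgn (fun i => (wt k i u x)%:E).
  apply: ereal_nondecreasing_is_cvgn => i j ij; rewrite lee_fin; exact: wt_mono.
have [d0|d0] := eqVneq d 0.
  rewrite d0 expr0n gtn_eqF// invr0 mulr0 mul0r; apply: lime_ge => //.
  by apply: nearW => i; rewrite lee_fin wt_ge0.
have dp : 0 < d by rewrite lt_neqAle eq_sym d0 hyp_dist_ge0.
pose z i := u x ^+ 2 * (d + arc (kap_ i))^-1 ^+ k * dens x.
have az i : 0 < arc (kap_ i) by apply: arc_gt0; exact: kap_gt1.
have zc : z i @[i --> \oo] --> u x ^+ 2 / d ^+ k * dens x.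
  apply: cvgM; last exact: cvg_cst.
  apply: cvgM; first exact: cvg_cst.
  rewrite -exprVn.
  have h : (d + arc (kap_ i))^-1 @[i --> \oo] --> d^-1.
    have h0 : d + arc (kap_ i) @[i --> \oo] --> d.
      rewrite -[X in _ --> X]addr0; apply: cvgD; first exact: cvg_cst.
      exact: arc_kap_cvg.
    exact: (cvgV d0 h0).
  apply: (@cvg_comp _ _ _ _ (fun y : R => y ^+ k) _ _ _ h).
  exact: exprn_continuous.
have zE : (z i)%:E @[i --> \oo] --> (u x ^+ 2 / d ^+ k * dens x)%:E.
  by apply/fine_cvgP; split => //; exact: nearW.
rewrite -(cvg_lim _ zE)//; apply: lee_lim => //.
  by apply/cvg_ex; exists (u x ^+ 2 / d ^+ k * dens x)%:E.
apply: nearW => i; rewrite lee_fin /z /wt.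
apply: ler_wpM2r; first by rewrite ltW// dens_gt0.
apply: ler_wpM2l; first exact: sqr_ge0.
apply: lerXn2r; rewrite ?nnegrE ?invr_ge0 ?addr_ge0 ?(ltW dp) ?(ltW (az i))//.
  by rewrite ltW// (rdist_gt0 ha (kap_gt1 _) hx).
rewrite lef_pV2 ?posrE ?addr_gt0 ?(rdist_gt0 ha (kap_gt1 _))//.
by have := hyp_dist_ge ha (kap_gt1 i) d0; rewrite rdist_pole lerBlDr.
Qed.

Let wlim k u : \bar R :=
  (\int[lebesgue_tuple R N]_t limn (fun i => (wt k i u (row_of t))%:E))%E.

Let nice_w k i u : tf u -> nice (fun x => u x ^+ 2 * invd a (kap_ i) x ^+ k).
Proof.
move=> tu; apply: niceMr; first by apply: nice_sqr; exact: tf_nice.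
by apply: contB_exp; exact: contB_invd ha (kap_gt1 i).
Qed.

Let wlim_cvg k u : tf u ->
  (hint (fun x => u x ^+ 2 * invd a (kap_ i) x ^+ k))%:E @[i --> \oo] --> wlim k u.
Proof.
move=> tu; rewrite /wlim.
have -> : (fun i => (hint (fun x => u x ^+ 2 * invd a (kap_ i) x ^+ k))%:E) =
  fun i => (\int[lebesgue_tuple R N]_t (wt k i u (row_of t))%:E)%E.
  by apply/funext => i; rewrite /hint -IntE//; exact: nice_Cc (nice_w k i tu).
apply: (@cvg_monotone_convergence _ _ R (lebesgue_tuple R N) setT measurableT
  (fun i t => (wt k i u (row_of t))%:E)) => //.
- move=> i; apply/measurable_EFinP.
  have [cw _] := nice_Cc (nice_w k i tu).
  exact: (measurable_continuous_row cw).
- by move=> i t _; rewrite lee_fin wt_ge0.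
- by move=> t _ i j ij; rewrite lee_fin wt_mono.
Qed.

Let dist_le_wlim k u : (0 < k)%N -> tf u ->
  (hyp_integral (fun x => (u x ^+ 2 / hyp_dist x a ^+ k)%R) <= wlim k u)%E.
Proof.
move=> k0 tu; rewrite /hyp_integral /riemannian_integral integral_mkcond.
apply: le_integralT_ge0 => t; rewrite patchE; case: ifPn => //.
- move=> _; rewrite lee_fin mulr_ge0 ?sqrtr_ge0//.
  by rewrite divr_ge0 ?sqr_ge0// exprn_ge0// hyp_dist_ge0.
- by rewrite inE /= => hx; rewrite vol_densityE//; exact: dist_le_lim.
move=> _; apply: lime_ge; last by apply: nearW => i; rewrite lee_fin wt_ge0.
by apply: ereal_nondecreasing_is_cvgn => i j ij; rewrite lee_fin wt_mono.
Qed.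

(** The bound [L] does not depend on kap, so it passes to the monotone limit, and that limit
    dominates the integrals with the geodesic distance. *)
Lemma pole_limit k1 k2 (c1 c2 L : R) u : (0 < k1)%N -> (0 < k2)%N ->
  0 <= c1 -> 0 <= c2 -> tf u ->
  (forall kap, 1 < kap ->
     c1 * hint (fun x => u x ^+ 2 * invd a kap x ^+ k1) +
     c2 * hint (fun x => u x ^+ 2 * invd a kap x ^+ k2) <= L) ->
  (c1%:E * hyp_integral (fun x => (u x ^+ 2 / hyp_dist x a ^+ k1)%R) +
   c2%:E * hyp_integral (fun x => (u x ^+ 2 / hyp_dist x a ^+ k2)%R) <= L%:E)%E.
Proof.
move=> k10 k20 c10 c20 tu h.
apply: (@le_trans _ _ (c1%:E * wlim k1 u + c2%:E * wlim k2 u)%E).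
  by apply: leeD; apply: lee_wpmul2l; rewrite ?lee_fin//; exact: dist_le_wlim.
have w0 k : (0 <= wlim k u)%E.
  apply: integral_ge0 => t _; apply: lime_ge.
    by apply: ereal_nondecreasing_is_cvgn => i j ij; rewrite lee_fin wt_mono.
  by apply: nearW => i; rewrite lee_fin wt_ge0.
have c : (c1%:E * (hint (fun x => u x ^+ 2 * invd a (kap_ i) x ^+ k1))%:E +
   c2%:E * (hint (fun x => u x ^+ 2 * invd a (kap_ i) x ^+ k2))%:E)%E @[i --> \oo] -->
   (c1%:E * wlim k1 u + c2%:E * wlim k2 u)%E.
  apply: cvgeD; first by rewrite ge0_adde_def// inE mule_ge0.
    by apply: cvgeZl => //; exact: wlim_cvg.
  by apply: cvgeZl => //; exact: wlim_cvg.
rewrite -(cvg_lim _ c)//; apply: lime_le; first by apply/cvg_ex; eexists; exact: c.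
by apply: nearW => i; rewrite -!EFinM -EFinD lee_fin h// kap_gt1.
Qed.

End pole_limit.

(** * Assembly of the constants for a fixed regularisation *)

Section fixed_regularisation.
Context {R : realType} {N : nat}.
Variables (a : 'rV[R]_N) (kap : R).
Hypotheses (ha : hyp_space a) (kap1 : 1 < kap).
Implicit Types u v : 'rV[R]_N -> R.

Notation hyp := (@hyp_space R N).
Notation N' := (N%:R : R).
Notation tf := (test_function hyp).
Notation invd := (invd a kap).
Notation n := (N' - 1).
Notation grad2 u := (inner (fun j => partial j u) (fun j => partial j u)).

(** The i-th chain step starts from the weight 4i + 4 = 4j with j = i + 1, and every squared Rellich
    constant contributes 1/16 to the power of 2. *)
Lemma prod_rellich_even m :
  9 / 16 * \prod_(i < m) @rellich_const R N (4 * i + 4).+2 ^+ 2 =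
  9 / 2 ^+ (4 * m.+1) *
  \prod_(1 <= j < m.+1) ((N' + 4 * j%:R) * (N' - 4 * j%:R - 4)) ^+ 2.
Proof.
rewrite big_add1 big_mkord /=.
have -> : \prod_(i < m) @rellich_const R N (4 * i + 4).+2 ^+ 2 =
  \prod_(i < m) (16^-1 * ((N' + 4 * i.+1%:R) * (N' - 4 * i.+1%:R - 4)) ^+ 2).
  apply: eq_bigr => i _; rewrite rellich_constE.
  have -> : (4 * i + 4)%:R = 4 * i.+1%:R :> R by rewrite -mulnSr natrM.
  by field.
rewrite big_split /= prodr_const card_ord exprM exprS.
have -> : (2 ^+ 4 : R) = 16 by ring.
by rewrite exprVn; field; rewrite expf_neq0.
Qed.

(** The factor j = 1 comes from [rellich_two]; the chain steps start from the weights 4i + 6 = 4j -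
    2 with j = i + 2. *)
Lemma prod_rellich_odd m :
  4^-1 * (@rellich_const R N 4 ^+ 2 *
     \prod_(i < m) @rellich_const R N (4 * i + 6).+2 ^+ 2) =
  1 / 2 ^+ (4 * m.+1 + 2) *
  \prod_(1 <= j < m.+2) ((N' + 4 * j%:R - 2) ^+ 2 * (N' - 4 * j%:R - 2) ^+ 2).
Proof.
rewrite big_add1 big_mkord /= big_ord_recl /=.
have -> : \prod_(i < m) @rellich_const R N (4 * i + 6).+2 ^+ 2 =
  \prod_(i < m) (16^-1 * ((N' + 4 * (bump 0 i).+1%:R - 2) ^+ 2 *
     (N' - 4 * (bump 0 i).+1%:R - 2) ^+ 2)).
  apply: eq_bigr => i _; rewrite rellich_constE /bump /= add1n.
  have -> : (4 * i + 6)%:R = 4 * i.+2%:R - 2 :> R.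
    by rewrite natrD natrM -[i.+2%:R]natr1 -[i.+1%:R]natr1; ring.
  by field.
rewrite big_split /= prodr_const card_ord exprD exprM.
have -> : (2 ^+ 4 : R) = 16 by ring.
rewrite [16 ^+ m.+1]exprS.
have -> : @rellich_const R N 4 = (N' + 4 - 2) * (N' - 4 - 2) / 4.
  by rewrite /rellich_const; field.
by rewrite exprVn; field; rewrite expf_neq0.
Qed.

(** [poincare_rellich] for the m-th iterate of the Laplacian on u, followed by [chain_two] on its
    r^-2 term and [chain_power] from weight 4 on its r^-4 term. *)
Lemma even_bound m u : (4 * m.+1 < N)%N -> tf u ->
  n ^+ (2 * m.+1) / 2 ^+ (4 * m.+1) * hint (fun x => u x ^+ 2 * invd x ^+ 2) +
  9 / 2 ^+ (4 * m.+1) *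
    \prod_(1 <= j < m.+1) ((N' + 4 * j%:R) * (N' - 4 * j%:R - 4)) ^+ 2 *
    hint (fun x => u x ^+ 2 * invd x ^+ (4 * m.+1)) <=
  hint (fun x => lapl (iter m lapl u) x ^+ 2) -
  n ^+ 2 / 4 * hint (grad2 (iter m lapl u)).
Proof.
move=> mN tu; have tv := tf_iter m tu.
have N4 : (4 < N)%N by apply: leq_ltn_trans mN; rewrite leq_pmulr.
apply: le_trans (poincare_rellich ha kap1 N4 tv).
have nv k : nice (fun x => iter m lapl u x ^+ 2 * invd x ^+ k).
  apply: niceMr; first by apply: nice_sqr; exact: tf_nice.
  by apply: contB_exp; exact: contB_invd.
have -> : (fun x => iter m lapl u x ^+ 2 *
    (n ^+ 2 / 16 * invd x ^+ 2 + 9 / 16 * invd x ^+ 4)) =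
  (fun x => n ^+ 2 / 16 * (iter m lapl u x ^+ 2 * invd x ^+ 2) +
     9 / 16 * (iter m lapl u x ^+ 2 * invd x ^+ 4)).
  by apply/funext => x; ring.
rewrite hintD; [|exact: niceZ..]; rewrite !hintZ//.
have n2 : 0 <= n ^+ 2 / 16 by rewrite divr_ge0// sqr_ge0.
apply: lerD.
  have -> : n ^+ (2 * m.+1) / 2 ^+ (4 * m.+1) = n ^+ 2 / 16 * (n ^+ 2 / 16) ^+ m.
    rewrite -exprS expr_div_n -exprM; congr (_ / _).
    by rewrite exprM; congr (_ ^+ _); ring.
  rewrite -mulrA; apply: ler_wpM2l => //.
  (* For m = 0 only N > 4 is known, short of the N > 6 that [chain_two] asks for, but then there is
     nothing to iterate. *)
  case: (posnP m) => [->|m0]; first by rewrite expr0 mul1r.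
  apply: chain_two => //; apply: leq_ltn_trans mN.
  by rewrite mulnS (leq_trans (_ : 6 <= 4 + 4 * 1)%N)// leq_add2l leq_pmul2l.
rewrite -prod_rellich_even -mulrA; apply: ler_wpM2l => //.
have := chain_power ha kap1 (k := 4) (m := m) isT _ tu.
by rewrite -mulnSr; apply; exact: ltnW.
Qed.

(** [poincare_hardy] gives 1/4 of the r^-2 integral of iterate m+1; [rellich_two] removes one
    Laplacian and splits it into the r^-2 and r^-6 terms that feed the two chains. *)
Lemma odd_bound m u : (4 * m.+1 + 2 < N)%N -> tf u ->
  n ^+ (2 * m.+1) / 2 ^+ (4 * m.+1 + 2) * hint (fun x => u x ^+ 2 * invd x ^+ 2) +
  1 / 2 ^+ (4 * m.+1 + 2) *
    \prod_(1 <= j < m.+2) ((N' + 4 * j%:R - 2) ^+ 2 * (N' - 4 * j%:R - 2) ^+ 2) *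
    hint (fun x => u x ^+ 2 * invd x ^+ (4 * m.+1 + 2)) <=
  hint (grad2 (iter m.+1 lapl u)) -
  n ^+ 2 / 4 * hint (fun x => iter m.+1 lapl u x ^+ 2).
Proof.
move=> mN tu; have tv := tf_iter m tu.
have N6 : (6 < N)%N.
  by apply: leq_ltn_trans mN; rewrite mulnS addnAC leq_addr.
have N2 : (2 < N)%N by apply: ltn_trans N6.
apply: le_trans (poincare_hardy ha kap1 N2 (tf_iter m.+1 tu)).
have e : (4 * m.+1 + 2 = 4 * m + 6)%N by rewrite mulnSr -addnA.
rewrite -prod_rellich_odd.
have -> : n ^+ (2 * m.+1) / 2 ^+ (4 * m.+1 + 2) =
    4^-1 * (n ^+ 2 / 16 * (n ^+ 2 / 16) ^+ m).
  rewrite -exprS expr_div_n -exprM exprD.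
  have -> : (16 : R) ^+ m.+1 = 2 ^+ (4 * m.+1) by rewrite exprM; congr (_ ^+ _); ring.
  by field; rewrite expf_neq0.
rewrite -(mulrA 4^-1) -(mulrA 4^-1) -mulrDr; apply: ler_wpM2l => //.
apply: le_trans (rellich_two ha kap1 N6 tv).
apply: lerD.
  rewrite -(mulrA (n ^+ 2 / 16)).
  apply: ler_wpM2l; first by rewrite divr_ge0// sqr_ge0.
  exact: chain_two.
rewrite -mulrA; apply: ler_wpM2l; first exact: sqr_ge0.
rewrite e; apply: chain_power => //.
by rewrite -e ltnW.
Qed.

End fixed_regularisation.

Theorem corollary1p4 (R : realType) (k N : nat) (hk : (0 < k)%N)
    (hN : (2 * k < N)%N) (x0 : 'rV[R]_N) (hx0 : hyp_space x0) :
  (forall m : nat, (0 < m)%N -> k = (2 * m)%N ->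
   forall u : 'rV[R]_N -> R, test_function (@hyp_space R N) u ->
   (hyp_integral (fun x => (iter m (@hyp_laplacian R N) u x) ^+ 2)%R
    - (((N%:R - 1) / 2) ^+ 2)%:E
      * hyp_integral (hyp_grad_sqnorm (iter m.-1 (@hyp_laplacian R N) u))
    >= ((N%:R - 1) ^+ (2 * m) / 2 ^+ (4 * m))%:E
       * hyp_integral (fun x => u x ^+ 2 / hyp_dist x x0 ^+ 2)%R
     + (9 / 2 ^+ (4 * m)
        * \prod_(1 <= j < m)
            ((N%:R + 4 * j%:R) * (N%:R - 4 * j%:R - 4)) ^+ 2)%:E
       * hyp_integral (fun x => u x ^+ 2 / hyp_dist x x0 ^+ (4 * m))%R)%E)
  /\
  (forall m : nat, (0 < m)%N -> k = (2 * m + 1)%N ->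
   forall u : 'rV[R]_N -> R, test_function (@hyp_space R N) u ->
   (hyp_integral (hyp_grad_sqnorm (iter m (@hyp_laplacian R N) u))
    - (((N%:R - 1) / 2) ^+ 2)%:E
      * hyp_integral (fun x => (iter m (@hyp_laplacian R N) u x) ^+ 2)%R
    >= ((N%:R - 1) ^+ (2 * m) / 2 ^+ (4 * m + 2))%:E
       * hyp_integral (fun x => u x ^+ 2 / hyp_dist x x0 ^+ 2)%R
     + (1 / 2 ^+ (4 * m + 2)
        * \prod_(1 <= j < m.+1)
            ((N%:R + 4 * j%:R - 2) ^+ 2 * (N%:R - 4 * j%:R - 2) ^+ 2))%:E
       * hyp_integral (fun x => u x ^+ 2 / hyp_dist x x0 ^+ (4 * m + 2))%R)%E).
Proof.
have sqrE : ((N%:R - 1) / 2) ^+ 2 = (N%:R - 1) ^+ 2 / 4 :> R by field.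
have gradE v : test_function (@hyp_space R N) v ->
    hyp_integral (hyp_grad_sqnorm v) =
    (hint (inner (fun j => partial j v) (fun j => partial j v)))%:E.
  move=> tv; apply: hyp_integralE => [|x]; last exact: hyp_grad_sqnormE.
  by apply: nice_inner => j; [exact: tf_partial_nice|case: (tf_partial_nice j tv)].
have sqE v : test_function (@hyp_space R N) v ->
    hyp_integral (fun x => v x ^+ 2)%R = (hint (fun x => v x ^+ 2))%:E.
  by move=> tv; apply: hyp_integralE => //; apply: nice_sqr; exact: tf_nice.
have n0 : 0 <= N%:R - 1 :> R.
  by rewrite subr_ge0 ler1n (leq_ltn_trans _ hN).
(* With m + 1 in place of m the predecessor disappears from the iterates, as in [even_bound] and
   [odd_bound]. *)
split=> -[//|m] _ km u tu.
- rewrite !iter_hyp_laplacian// sqE ?gradE; try exact: tf_iter.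
  (* All iterates are test functions, so the upper side is a real number, as [pole_limit]
     requires. *)
  rewrite sqrE -EFinM -EFinB.
  apply: pole_limit => //.
  + by rewrite divr_ge0// exprn_ge0.
  + by rewrite mulr_ge0 ?divr_ge0 ?exprn_ge0// prodr_ge0// => j _; exact: sqr_ge0.
  + move=> kap kap1; apply: even_bound => //.
    by apply: leq_ltn_trans hN; rewrite km mulnA.
- rewrite !iter_hyp_laplacian// sqE ?gradE; try exact: tf_iter.
  rewrite sqrE -EFinM -EFinB.
  apply: pole_limit => //.
  + by rewrite divr_ge0// exprn_ge0.
  + rewrite mulr_ge0 ?divr_ge0 ?exprn_ge0// prodr_ge0// => j _.
    by rewrite mulr_ge0 ?sqr_ge0.
  + move=> kap kap1; apply: odd_bound => //.
    by apply: leq_ltn_trans hN; rewrite km mulnDr mulnA.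
Qed.
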